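(* Let $k\ge 2$. For all sufficiently large $n$, the complex $\Delta^{2k-1}_n$ admits exactly two automorphisms: the identity and the automorphism induced by the involution $i\mapsto -i$ of $V_n$. (An automorphism is a bijection $\phi:V_n\to V_n$ such that $\sigma\in\Delta^{2k-1}_n$ if and only if $\phi(\sigma)\in\Delta^{2k-1}_n$.)
   Context: Simplicial complexes are finite abstract simplicial complexes. For a finite set $A$, $\overline{A}$ is the simplex of all subsets of $A$. $V_n=\{\pm1,\dots,\pm n\}$. For a set $\sigma$ of integers, $-\sigma=\{-v:v\in\sigma\}$; for a complex $\Gamma$, $-\Gamma=\{-\sigma:\sigma\in\Gamma\}$. The join is $\Gamma*\Gamma'=\{\sigma\cup\tau:\sigma\in\Gamma,\tau\in\Gamma'\}$ (disjoint vertex sets); $\Gamma*v:=\Gamma*\overline{\{v\}}$. A path $(v_1,\dots,v_m)$ is the 1-dimensional complex with edges $\{v_j,v_{j+1}\}$ (a cycle if $v_m=v_1$). $\partial C^*_m$ is the complex of all subsets of $V_m$ containing no pair $\{j,-j\}$. For a pure complex $\Delta$ and pure full-dimensional subcomplex $\Gamma$, $\Delta\setminus\Gamma$ is the subcomplex generated by the facets of $\Delta$ not in $\Gamma$. $\partial B$ is the boundary complex of a combinatorial ball $B$. The complexes $\Delta^d_n$ ($d\ge1$, $n\ge d+1$) and $B^{d,i}_n$ are defined recursively: $\Delta^1_n$ is the cycle $(1,2,\dots,n,-1,\dots,-n,1)$; $\Delta^d_{d+1}=\partial C^*_{d+1}$; $B^{d,j}_n=\emptyset$ for $j<0$; $B^{1,0}_n=\overline{\{-1,n\}}$;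 for $k\ge1$, $n\ge2k$: $B^{2k-1,k}_n=\Delta^{2k-1}_n\setminus B^{2k-1,k-1}_n$; for $d\ge2$, $n\ge d+1$, $i\le\lfloor d/2\rfloor$: $B^{d,i}_n=(B^{d-1,i}_{n-1}*n)\cup((-B^{d-1,i-1}_{n-1})*(-n))$; $\Delta^d_{n+1}$ is obtained from $\Delta^d_n$ by replacing $B=B^{d,\lceil d/2\rceil-1}_n$ with $\partial B*(n+1)$ and $-B$ with $\partial(-B)*(-n-1)$. (These are known to be well defined; $\Delta^d_n$ is a combinatorial $d$-sphere on $V_n$ invariant under $v\mapsto-v$.) *)

(* Defs.v *)
From mathcomp Require Import all_boot all_order all_algebra all_fingroup.
From mathcomp Require Export finmap.

Set Implicit Arguments.
Unset Strict Implicit.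
Unset Printing Implicit Defensive.

Import Order.TTheory GRing.Theory Num.Theory.

Local Open Scope fset_scope.
Local Open Scope ring_scope.

(* A finite abstract simplicial complex with integer vertices is given by its
   set of faces.  [fset0] is the complex with no face at all (not even the
   empty face), so its join with any complex is again [fset0]. *)
Notation complex := {fset {fset int}}.

Definition simplex (A : {fset int}) : complex := fpowerset A.

Definition generated (S : complex) : complex := \bigcup_(F <- S) fpowerset F.

Definition neg_set (s : {fset int}) : {fset int} := [fset - v | v in s].

Definition neg_complex (X : complex) : complex := [fset neg_set s | s in X].

Definition join (X Y : complex) : complex := [fset s `|` t | s in X, t in Y].

Definition cone (X : complex) (v : int) : complex := join X (simplex [fset v]).

Definition path_complex (p : seq int) : complex :=
  generated [fset [fset e.1; e.2] | e in zip p (behead p)].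

Definition facets (X : complex) : complex :=
  [fset F in X | all (fun G => (F `<=` G) ==> (F == G)) X].

(* X \ Y: generated by the facets of X that are not in Y. *)
Definition cdiff (X Y : complex) : complex :=
  generated [fset F in facets X | F \notin Y].

(* The codimension-one faces of a pure complex. *)
Definition ridges (X : complex) : complex :=
  \bigcup_(F <- facets X) [fset F `\ v | v in F].

(* The boundary complex of a combinatorial ball is generated by the
   codimension-one faces lying in exactly one facet. *)
Definition boundary (B : complex) : complex :=
  generated [fset R in ridges B | #|` [fset F in facets B | R `<=` F]| == 1%N].

(* X with B replaced by the cone over the boundary of B with apex v. *)
Definition replace (X B : complex) (v : int) : complex :=
  cdiff X B `|` cone (boundary B) v.

Definition V (n : nat) : {fset int} :=
  [fset i%:Z | i in iota 1 n] `|` [fset - i%:Z | i in iota 1 n].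

Definition cross_boundary (m : nat) : complex :=
  [fset s in fpowerset (V m) | all (fun v => - v \notin s) s].

(* The cycle (1, 2, ..., n, -1, ..., -n, 1). *)
Definition Delta1 (n : nat) : complex :=
  path_complex ([seq i%:Z | i <- iota 1 n] ++
                [seq - i%:Z | i <- iota 1 n] ++ [:: 1]).

(* The recursion defining Delta^d_n and B^{d,i}_n is well-founded in the
   following order: first B^{d,i}_n for i <= d./2 (from dimension d - 1), then
   Delta^d_n (by induction on n), then B^{2k-1,k}_n.  [sphere_of d b] and
   [ball_of d b] perform the last two steps, [b i n] standing for B^{d,i}_n,
   i <= d./2.  The recursion equations are proved below; values outside the
   range of indices of the definition are irrelevant. *)
Fixpoint sphere_from (d : nat) (b : int -> nat -> complex) (m : nat) : complex :=
  if m is m'.+1 then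
    let n := (m' + d.+1)%N in
    let B := b ((uphalf d)%:Z - 1) n in
    replace (replace (sphere_from d b m') B n.+1%:Z) (neg_complex B) (- n.+1%:Z)
  else cross_boundary d.+1.

Definition sphere_of (d : nat) (b : int -> nat -> complex) (n : nat) : complex :=
  if d == 1%N then Delta1 n else sphere_from d b (n - d.+1).

Definition ball_of (d : nat) (b : int -> nat -> complex) (i : int) (n : nat) :
    complex :=
  if odd d && (i == (uphalf d)%:Z) then cdiff (sphere_of d b n) (b (i - 1) n)
  else b i n.

Fixpoint low_ball (d : nat) : int -> nat -> complex :=
  match d with
  | 0 => fun _ _ => fset0
  | 1 => fun i n => if i == 0 then simplex [fset - 1; n%:Z] else fset0
  | d'.+1 => fun i n =>
      if (0 <= i) && (i <= (d./2)%:Z) then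
        let b := ball_of d' (low_ball d') in
        cone (b i n.-1) n%:Z `|` cone (neg_complex (b (i - 1) n.-1)) (- n%:Z)
      else fset0
  end.

Definition Delta (d n : nat) : complex := sphere_of d (low_ball d) n.

Definition ball (d : nat) (i : int) (n : nat) : complex :=
  ball_of d (low_ball d) i n.

Lemma subr1_neq (i : int) : (i - 1 == i) = false.
Proof. by rewrite lt_eqF // gtrBl. Qed.

Lemma join0l X : join fset0 X = fset0.
Proof. by apply/fsetP=> s; rewrite inE; apply/imfset2P=> -[]. Qed.

Lemma neg_complex0 : neg_complex fset0 = fset0.
Proof. by apply/fsetP=> s; rewrite inE; apply/imfsetP=> -[]. Qed.

Lemma ball_neg d i n : i < 0 -> ball d i n = fset0.
Proof.
move=> i_lt0; rewrite /ball /ball_of.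
have -> : (i == (uphalf d)%:Z) = false by case: i i_lt0.
by rewrite andbF; case: d => [|[|d]] //=; case: i i_lt0.
Qed.

Lemma ball_1_0 n : ball 1 0 n = simplex [fset - 1; n%:Z].
Proof. by []. Qed.

Lemma ball_compl k n : (0 < k)%N ->
  ball (2 * k - 1) k%:Z n =
  cdiff (Delta (2 * k - 1) n) (ball (2 * k - 1) (k%:Z - 1) n).
Proof.
case: k => // k _; have -> : (2 * k.+1 - 1 = k.*2.+1)%N by rewrite mulnS mul2n.
have u : uphalf k.*2.+1 = k.+1 by rewrite /= doubleK.
by rewrite /ball /ball_of u subr1_neq andbF /= odd_double eqxx.
Qed.

Lemma ball_rec d i n : (1 < d)%N -> i <= (d./2)%:Z ->
  ball d i n = cone (ball d.-1 i n.-1) n%:Z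
    `|` cone (neg_complex (ball d.-1 (i - 1) n.-1)) (- n%:Z).
Proof.
move=> d_gt1 le_i; case: (ltP i 0) => [i_lt0|i_ge0].
  have i1 : i - 1 < 0 by rewrite subr_lt0 (lt_trans i_lt0).
  by rewrite !ball_neg // neg_complex0 /cone !join0l fsetU0.
rewrite {1}/ball /ball_of; case: ifP => [/andP[od /eqP ei]|_].
  by move: le_i; rewrite ei lez_nat uphalf_half od add1n ltnn.
by case: d d_gt1 le_i => [|[|d]] // _ le_i; rewrite [LHS]/= i_ge0 le_i.
Qed.

Lemma Delta_1 n : Delta 1 n = Delta1 n.
Proof. by []. Qed.

Lemma Delta_cross d : (1 < d)%N -> Delta d d.+1 = cross_boundary d.+1.
Proof. by case: d => [|[|d]] // _; rewrite /Delta /sphere_of /= subnn. Qed.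

Lemma Delta_rec d n : (1 < d < n)%N ->
  let B := ball d ((uphalf d)%:Z - 1) n in
  Delta d n.+1 =
  replace (replace (Delta d n) B n.+1%:Z) (neg_complex B) (- n.+1%:Z).
Proof.
move=> /andP[d_gt1 lt_dn] /=; rewrite /ball /ball_of subr1_neq andbF.
rewrite /Delta /sphere_of gtn_eqF // subSn // [LHS]/= subnK //.
Qed.

Lemma V_opp n v : v \in V n -> - v \in V n.
Proof.
rewrite !inE => /orP[] /imfsetP[i /= iP ->]; apply/orP; [right|left];
  by rewrite ?opprK; apply/imfsetP; exists i.
Qed.

Definition opp_V (n : nat) (v : V n) : V n := [` V_opp (valP v)].

Lemma opp_V_inj n : injective (@opp_V n).
Proof. by move=> u v /(congr1 val) /= /oppr_inj /val_inj. Qed.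

Definition antipode (n : nat) : {perm V n} := perm (@opp_V_inj n).

(* A set s of elements of the type [V n], as a set of integers. *)
Definition face_of (n : nat) (s : {set V n}) : {fset int} :=
  [fset val v | v in s].

Definition automorphisms (n : nat) (X : complex) : {set {perm V n}} :=
  [set phi : {perm V n} |
    [forall s : {set V n}, (face_of s \in X) == (face_of (phi @: s) \in X)]].

(* Main.v *)
Require Import Defs.
From mathcomp Require Import all_boot all_order all_algebra all_fingroup.
From mathcomp Require Import zify finmap.

Set Implicit Arguments.
Unset Strict Implicit.
Unset Printing Implicit Defensive.

Import Order.TTheory GRing.Theory Num.Theory.

(** The hard part is to show that a vertex is not special: this takes facets through it that avoid
    arbitrary [p], [-p] and [q], in every dimension. One mechanism provides nearly all of them. The
    facets through [n] and [n-2] that avoid [n-1] and [-(n-1)] come from those facets of the sphere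
    two dimensions lower that lie outside two of its balls. Hence a pair [j], [j+2] can be joined to
    a suitable lower-dimensional facet below [j], starting from an edge of the cycle. There is
    freedom in placing such pairs or the lower facet, and of three disjoint ranges one misses [p]
    and [q].

    The facets so built must survive when [n] grows. Every facet of a replaced ball contains [n] or
    [-n], so a facet that survives one step without the new vertices survives all later ones; the
    constructions therefore work with such stable facets.

    The signs are the second difficulty: [p] counts with both signs and [q] with one only. Facets
    containing [n] and [-(n-1)], or small negative vertices, tell the two roles apart. *)

(** A facet is a sign pattern on [1, ..., n], and the recursion reads off its
    letters from the top.  Modulo 2 the boundary of [B^{d,i}_n] obeys the same
    kind of recursion, and since a ridge of the complexes at hand lies in at
    most two facets, "exactly one facet" may be replaced by parity.

    Call [v] special if there are [p], different from [v] and [-v], and [q],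
    different from [v], such that every facet through [v] contains [p], [-p] or
    [q].  A facet through [n] contains [n-1], [-(n-1)] or [n-2], so [n] is special; the only other special vertices are [-n], [2]
    and [-2], because any other vertex lies on facets which have little else in
    common.  As the complex is 2-neighborly, an automorphism [f] commutes with
    the antipode, and it permutes the special vertices.  The neighbourhoods of
    [n] and [2] differ, so that [f n = n] after composing with the antipode.
    Then [f] fixes [n-1] and [n-2], and, going down, every [j] that is not too
    small: the facets in [V (j+2)] through [j+2] avoiding [j+1] and [-(j+1)]
    all contain [j].  A small vertex [a] is fixed because a suitable ridge
    through [a+1] lies in two facets only, the other ends being [a] and
    [a+2]. *)

(** * Words describing facets *)

(* The head of a word [w] is the letter of the vertices [+-size w]: [Some true]
   stands for [size w], [Some false] for [- size w], [None] for neither. *)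
Notation word := (seq (option bool)).

Definition wneg (w : word) : word := map (omap negb) w.

(** The word of the single vertex [-1], whose cone with apex [n] is the edge [{-1, n}]. *)
Fixpoint point_b (w : word) : bool :=
  match w with
  | [::] => false
  | a :: w' => if w' is [::] then a == Some false else (a == None) && point_b w'
  end.

(** In terms of [s = d + 1 - 2 i], passing to dimension [d - 1] turns [s] into [s - 1] if [i] is
    kept, and into [s + 1] if [i] drops by one; in the second case the ball is also negated. *)
Definition ball_step (b : nat -> word -> bool) (s : nat) (w : word) : bool :=
  match w with
  | Some true :: w' => b s.-1 w'
  | Some false :: w' => b s.+1 (wneg w')
  | _ => false
  end.

(** The boundary modulo 2 of a union of cones with apices [n] and [-n]: the cones over the two
    boundaries, plus the two bases, whose common facets cancel. *)
Definition bd_step (b db : nat -> word -> bool) (s : nat) (w : word) : bool :=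
  match w with
  | Some true :: w' => db s.-1 w'
  | Some false :: w' => db s.+1 (wneg w')
  | None :: w' => b s.-1 w' (+) b s.+1 (wneg w')
  | [::] => false
  end.

(** Here [b] and [db] stand for the replaced ball and its boundary. In odd dimension
    [i = (d+1)/2 - 1] gives level [s = 2]. Words of length [d + 1] describe the cross-polytope, and
    this is also the start for [d = 1], as a 4-cycle. *)
Fixpoint sph_step (d : nat) (b db : word -> bool) (w : word) : bool :=
  match w with
  | [::] => false
  | a :: w' =>
    if (size w' <= d)%N then (size w' == d) && all isSome w
    else match a with
    | Some true => db w'
    | Some false => db (wneg w')
    | None => [&& sph_step d b db w', ~~ b w' & ~~ b (wneg w')]
    end
  end.

(* With [s = d + 1 - 2 i], [(lev d).1 s] recognizes the facets of [B^{d,i}_n] and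
   [(lev d).2 s] those of its boundary, [n] being the length of the word; so
   [s = 0] is the complementary ball [B^{2k-1,k}_n].  Dimension 0 is made up so
   that the step yields [B^{1,0}_n]. *)
Fixpoint lev (d : nat) : (nat -> word -> bool) * (nat -> word -> bool) :=
  match d with
  | 0 => (fun s w => (s == 1) && point_b w, fun s w => (s == 1) && all (pred1 None) w)
  | d'.+1 =>
    let b := ball_step (lev d').1 in
    let db := bd_step (lev d').1 (lev d').2 in
    (fun s w => if s is 0 then sph_step d (b 2) (db 2) w && ~~ b 2 w else b s w,
     fun s w => db (if s is 0 then 2 else s) w)
  end.

Definition ballw d := (lev d).1.
Definition bdw d := (lev d).2.
Definition sphw d := sph_step d (ballw d 2) (bdw d 2).

Lemma ballw0E s w : ballw 0 s w = (s == 1) && point_b w. Proof. by []. Qed.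
Lemma bdw0E s w : bdw 0 s w = (s == 1) && all (pred1 None) w. Proof. by []. Qed.
Lemma ballw_compl d w : ballw d.+1 0 w = sphw d.+1 w && ~~ ballw d.+1 2 w.
Proof. by []. Qed.
Lemma ballw_pos d s w : ballw d.+1 s.+1 (Some true :: w) = ballw d s w. Proof. by []. Qed.
Lemma ballw_neg d s w : ballw d.+1 s.+1 (Some false :: w) = ballw d s.+2 (wneg w).
Proof. by []. Qed.
Lemma ballw_zero d s w : ballw d.+1 s.+1 (None :: w) = false. Proof. by []. Qed.
Lemma ballw_nil d s : ballw d s [::] = false.
Proof. by case: d s => [|d] [|s] //=; rewrite ballw0E andbF. Qed.
Lemma bdw_compl d w : bdw d.+1 0 w = bdw d.+1 2 w. Proof. by []. Qed.
Lemma bdw_pos d s w : bdw d.+1 s.+1 (Some true :: w) = bdw d s w. Proof. by []. Qed.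
Lemma bdw_neg d s w : bdw d.+1 s.+1 (Some false :: w) = bdw d s.+2 (wneg w).
Proof. by []. Qed.
Lemma bdw_zero d s w :
  bdw d.+1 s.+1 (None :: w) = ballw d s w (+) ballw d s.+2 (wneg w).
Proof. by []. Qed.

Lemma sphw_small d w : (size w <= d.+1)%N -> sphw d w = (size w == d.+1) && all isSome w.
Proof. by case: w => [|a w] //=; rewrite ltnS => h; rewrite /sphw /= h eqSS. Qed.
Lemma sphw_pos d w : (d < size w)%N -> sphw d (Some true :: w) = bdw d 2 w.
Proof. by rewrite /sphw /= ltnNge => /negbTE ->. Qed.
Lemma sphw_neg d w : (d < size w)%N -> sphw d (Some false :: w) = bdw d 2 (wneg w).
Proof. by rewrite /sphw /= ltnNge => /negbTE ->. Qed.
Lemma sphw_zero d w : (d < size w)%N ->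
  sphw d (None :: w) = [&& sphw d w, ~~ ballw d 2 w & ~~ ballw d 2 (wneg w)].
Proof. by rewrite /sphw /= ltnNge => /negbTE ->. Qed.

Arguments ballw : simpl never.
Arguments bdw : simpl never.
Arguments sphw : simpl never.

Lemma wnegK : involutive wneg.
Proof. by elim=> //= -[[]|] w -> . Qed.
Lemma size_wneg w : size (wneg w) = size w. Proof. exact: size_map. Qed.
Lemma all_isSome_wneg w : all isSome (wneg w) = all isSome w.
Proof. by rewrite all_map; apply: eq_all => -[]. Qed.

Lemma sphw_wneg d w : sphw d (wneg w) = sphw d w.
Proof.
elim: w => // a w IH.
case: (ltnP d (size w)) => h; last by rewrite !sphw_small ?size_wneg ?all_isSome_wneg.
case: a => [[]|] /=; rewrite ?sphw_pos ?sphw_neg ?sphw_zero ?size_wneg // wnegK //.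
by rewrite IH; congr (_ && _); rewrite andbC.
Qed.

Definition nz (w : word) := count isSome w.
Lemma nz_wneg w : nz (wneg w) = nz w.
Proof. by rewrite /nz count_map; apply: eq_count => -[]. Qed.

(** Purity. The two statements need a joint induction, since a boundary word with head [None] comes
    from a ball one dimension lower. *)
Lemma nz_bd d s w : (ballw d s w -> nz w = d.+1) /\ (bdw d s w -> nz w = d).
Proof.
elim: d s w => [|d IH] s w.
  rewrite ballw0E bdw0E; split=> /andP[_].
    elim: w => //= a w IH; case: w IH => [|a' w] IH; first by move/eqP=> ->.
    by move=> /andP[/eqP -> /IH].
  by elim: w => //= -[] //= w IH /IH.
have st s' w' : (ballw d.+1 s'.+1 w' -> nz w' = d.+2) /\ (bdw d.+1 s'.+1 w' -> nz w' = d.+1).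
  case: w' => [|[[]|] w']; split=> //; rewrite ?ballw_pos ?ballw_neg ?bdw_pos ?bdw_neg ?bdw_zero //.
  - by move/(IH _ _).1; rewrite /nz /= => ->.
  - by move/(IH _ _).2; rewrite /nz /= => ->.
  - by move/(IH _ _).1; rewrite nz_wneg /nz /= => ->.
  - by move/(IH _ _).2; rewrite nz_wneg /nz /= => ->.
  case e: (ballw d s' w'); first by move=> _; apply: ((IH _ _).1 e).
  by move/(IH _ _).1; rewrite nz_wneg.
case: s => [|s]; last exact: st.
rewrite bdw_compl; split; last exact: (st _ _).2.
rewrite ballw_compl => /andP[+ _].
elim: w => // a w IHw.
case: (ltnP d.+1 (size w)) => h.
  case: a => [[]|]; rewrite ?sphw_pos ?sphw_neg ?sphw_zero //.
  - by move/(st _ _).2; rewrite /nz /= => ->.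
  - by move/(st _ _).2; rewrite nz_wneg /nz /= => ->.
  by case/andP=> /IHw.
by rewrite sphw_small // => /andP[/eqP sz]; rewrite all_count /nz => /eqP ->.
Qed.

Lemma nz_ballw d s w : ballw d s w -> nz w = d.+1. Proof. exact: (nz_bd d s w).1. Qed.
Lemma nz_bdw d s w : bdw d s w -> nz w = d. Proof. exact: (nz_bd d s w).2. Qed.
Lemma nz_sphw d w : sphw d w -> nz w = d.+1.
Proof.
elim: w => // a w IHw.
case: (ltnP d (size w)) => h.
  case: a => [[]|]; rewrite ?sphw_pos ?sphw_neg ?sphw_zero //.
  - by move/nz_bdw; rewrite /nz /= => ->.
  - by move/nz_bdw; rewrite nz_wneg /nz /= => ->.
  by case/andP=> /IHw.
by rewrite sphw_small // => /andP[/eqP sz]; rewrite all_count /nz => /eqP ->.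
Qed.

(* In order: [B^{d,i}] contains [- B^{d,i-1}] and is disjoint from [B^{d,i-1}]; it
   lies on the boundaries of [B^{d+1,i}] and [B^{d+1,i+1}]. *)
Lemma word_structure d :
  [/\ forall s w, odd (d + s) -> (d < size w)%N -> ballw d s.+2 (wneg w) -> ballw d s w,
      forall s w, odd (d + s) -> (d < size w)%N -> ballw d s w -> ~~ ballw d s.+2 w,
      forall s w, odd (d + s) -> (d.+1 < size w)%N -> ballw d s w -> bdw d.+1 s.+1 w &
      forall s w, odd (d + s.+1) -> (d.+1 < size w)%N -> ballw d s.+1 w -> bdw d.+1 s w].
Proof.
elim: d => [|d [C1 Dj K1 K2]].
  have K s w : (1 < size w)%N -> ballw 0 s w -> bdw 1 2 w /\ s = 1.
    rewrite ballw0E => sz /andP[/eqP -> ]; case: w sz => [|a [|a' w]] //= _ /andP[/eqP -> h].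
    by rewrite bdw_zero !ballw0E /= h.
  split=> s w _ sz //.
    by move=> h; have [h1 ->] := K s w sz h.
  by move=> h; have [h1 [->]] := K s.+1 w sz h; rewrite bdw_compl.
have dd e : d.+1 + e.+1 = (d + e).+2 by lia.
have C1p s w : odd (d.+1 + s.+1) -> (d.+1 < size w)%N ->
    ballw d.+1 s.+3 (wneg w) -> ballw d.+1 s.+1 w.
  (* With head [Some true] the inclusion in dimension [d] is used twice, from level [s + 4] through
     [s + 2] to [s]; with head [Some false] both sides coincide. *)
  rewrite dd /= negbK; case: w => [|[[]|] w] //= os; rewrite ltnS => sz.
  rewrite ballw_neg ballw_pos wnegK => h; apply: (C1 _ _) => //; apply: C1; rewrite ?size_wneg ?wnegK //.
  by rewrite !addnS /= negbK.
have Djp s w : odd (d.+1 + s.+1) -> (d.+1 < size w)%N ->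
    ballw d.+1 s.+1 w -> ~~ ballw d.+1 s.+3 w.
  rewrite dd /= negbK; case: w => [|[[]|] w] //= os; rewrite ltnS => sz.
    by rewrite !ballw_pos; apply: Dj.
  by rewrite !ballw_neg; apply: Dj; rewrite ?size_wneg // !addnS /= negbK.
(* Level 0 is not reached by reading heads. It follows from [sub] and [dis]: the replaced ball lies
   in the sphere and is disjoint from its antipode. *)
have sub w : odd d.+1 -> (d.+1 < size w)%N -> ballw d.+1 2 w -> sphw d.+1 w.
  move=> od; case: w => // a w; rewrite /= ltnS leq_eqVlt => /orP[/eqP sz|sz].
    move/nz_ballw=> h; rewrite sphw_small /= -?sz // eqxx /= -/(all isSome (a :: w)).
    by rewrite all_count -/(nz (a :: w)) h /= sz.
  case: a => [[]|] //.
    by rewrite ballw_pos sphw_pos // => h; apply: K1 => //; rewrite addn1.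
  rewrite ballw_neg sphw_neg // => h; apply: K2; rewrite ?size_wneg //.
  by rewrite !addnS addn0 /= negbK.
have dis w : odd d.+1 -> (d.+1 < size w)%N -> ballw d.+1 2 (wneg w) -> ~~ ballw d.+1 2 w.
  move=> od; case: w => // -[[]|] w; rewrite /= ltnS => sz //.
    rewrite ballw_pos ballw_neg wnegK; apply/contraTN; apply: Dj => //.
    by rewrite addn1.
  by rewrite ballw_pos ballw_neg; apply: Dj; rewrite ?addn1 ?size_wneg.
have C1f s w : odd (d.+1 + s) -> (d.+1 < size w)%N ->
    ballw d.+1 s.+2 (wneg w) -> ballw d.+1 s w.
  case: s => [|s]; last exact: C1p.
  rewrite addn0 => od sz h; rewrite ballw_compl dis // andbT -sphw_wneg sub //.
  by rewrite size_wneg.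
have Djf s w : odd (d.+1 + s) -> (d.+1 < size w)%N -> ballw d.+1 s w -> ~~ ballw d.+1 s.+2 w.
  by case: s => [|s]; [rewrite ballw_compl => _ _ /andP[]|apply: Djp].
have L1 w : odd d.+1 -> (d.+2 < size w)%N -> bdw d.+2 1 w = sphw d.+1 w.
  move=> od; case: w => // -[[]|] w; rewrite /= ltnS => sz.
  - by rewrite bdw_pos bdw_compl sphw_pos.
  - by rewrite bdw_neg sphw_neg.
  rewrite bdw_zero ballw_compl sphw_zero //; have := @C1f 0 w; rewrite addn0 ballw_compl.
  by case: (ballw d.+1 2 (wneg w)) => [/(_ od sz erefl) ->|_] /=; rewrite ?andbF // andbT addbF.
have K1f s w : odd (d.+1 + s) -> (d.+2 < size w)%N ->
    ballw d.+1 s w -> bdw d.+2 s.+1 w.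
  case: s => [|s]; first by rewrite addn0 => od sz; rewrite ballw_compl L1 // => /andP[].
  rewrite dd /= negbK; case: w => [|[[]|] w] //= os; rewrite ltnS => sz.
    by rewrite ballw_pos bdw_pos; apply: K1.
  by rewrite ballw_neg bdw_neg; apply: K1; rewrite ?size_wneg // !addnS /= negbK.
split=> // -[|s] w; first by move=> od sz h; rewrite bdw_compl; apply: K1f.
rewrite dd /= negbK; case: w => [|[[]|] w] //= os; rewrite ltnS => sz.
  by rewrite ballw_pos bdw_pos; apply: K2.
by rewrite ballw_neg bdw_neg; apply: K2; rewrite ?size_wneg // addnS addnS /= negbK.
Qed.

Lemma ballw_wneg_sub d s w :
  odd (d + s) -> (d < size w)%N -> ballw d s.+2 (wneg w) -> ballw d s w.
Proof. by have [+ _ _ _] := word_structure d; apply. Qed.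

Lemma sphw_ballw d w : odd d -> (d < size w)%N -> ballw d 2 w -> sphw d w.
Proof.
case: d => // d od sz h; have := @ballw_wneg_sub d.+1 0 (wneg w).
by rewrite addn0 size_wneg wnegK ballw_compl sphw_wneg => /(_ od sz h) /andP[].
Qed.

Lemma ballw_wneg_disj d w : odd d -> (d < size w)%N -> ballw d 2 (wneg w) -> ~~ ballw d 2 w.
Proof.
case: d => // d od sz h; have := @ballw_wneg_sub d.+1 0 w.
by rewrite addn0 ballw_compl => /(_ od sz h) /andP[].
Qed.

(** The sphere bounds a ball one dimension up. At head [None] the complementary ball is added modulo
    2 to the antipode of the replaced ball [B]; as it contains the latter, what remains is the
    sphere without [B] and [-B]. *)
Lemma bdw_sphere d w : odd d -> (d.+1 < size w)%N -> bdw d.+1 1 w = sphw d w.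
Proof.
case: d => // d od; case: w => // -[[]|] w; rewrite /= ltnS => sz.
- by rewrite bdw_pos bdw_compl sphw_pos.
- by rewrite bdw_neg sphw_neg.
rewrite bdw_zero ballw_compl sphw_zero //; have := @ballw_wneg_sub d.+1 0 w.
rewrite addn0 ballw_compl.
by case: (ballw d.+1 2 (wneg w)) => [/(_ od sz erefl) ->|_] /=; rewrite ?andbF // andbT addbF.
Qed.

(** * Ridges *)

Fixpoint cofaces (r : word) : seq word :=
  if r is a :: r' then
    (if a is None then [:: Some true :: r'; Some false :: r'] else [::])
      ++ map (cons a) (cofaces r')
  else [::].

Lemma size_cofaces r w : w \in cofaces r -> size w = size r.
Proof.
elim: r w => //= a r IH w; rewrite mem_cat => /orP[|/mapP[u /IH h ->]] /=; last by rewrite h.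
by case: a => // ; rewrite !inE => /orP[] /eqP ->.
Qed.

Lemma count_cofaces_neg (P : pred word) r :
  count (fun w => P (wneg w)) (cofaces r) = count P (cofaces (wneg r)).
Proof.
elim: r P => //= a r IH P; rewrite !count_cat !count_map.
have -> : count (preim (cons a) (fun w => P (wneg w))) (cofaces r)
   = count (preim (cons (omap negb a)) P) (cofaces (wneg r)) by rewrite -IH.
by congr addn; case: a => [[]|] //=; rewrite !addn0 addnC.
Qed.

Lemma count_cofaces_zero (P : pred word) r :
  count P (cofaces (None :: r)) =
    P (Some true :: r) + P (Some false :: r)
      + count (fun w => P (None :: w)) (cofaces r).
Proof. by rewrite /= count_map addnA. Qed.

Lemma count_cofaces_some (P : pred word) e r :
  count P (cofaces (Some e :: r)) = count (fun w => P (Some e :: w)) (cofaces r).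
Proof. by rewrite /= count_map. Qed.

(** Under an inclusion the sum modulo 2 of [bd_step] is a difference, so that numbers, and not only
    parities, can be computed. *)
Lemma count_addb_sub (T : eqType) (P Q : pred T) (s : seq T) :
  {in s, forall x, Q x -> P x} ->
  count (fun x => P x (+) Q x) s = count P s - count Q s /\ (count Q s <= count P s)%N.
Proof.
move=> sub.
have h : count (fun x => P x (+) Q x) s + count Q s = count P s.
  elim: s sub => //= x s IH sub.
  have <- := IH (fun y hy => sub y (@mem_behead _ (x :: s) _ hy)).
  by have := sub x (mem_head _ _); case: (P x); case: (Q x) => //=; lia.
by rewrite -h addnK leq_addl.
Qed.

Lemma count_excl (T : eqType) (P Q R : pred T) (s : seq T) :
  {in s, forall x, Q x -> P x} -> {in s, forall x, R x -> P x} ->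
  {in s, forall x, R x -> ~~ Q x} ->
  count (fun x => [&& P x, ~~ Q x & ~~ R x]) s + count Q s + count R s = count P s.
Proof.
elim: s => //= x s IH hQ hR hd.
have sb := fun y hy => @mem_behead _ (x :: s) y hy.
have := IH (fun y hy => hQ y (sb y hy)) (fun y hy => hR y (sb y hy)) (fun y hy => hd y (sb y hy)).
have := hQ x (mem_head _ _); have := hR x (mem_head _ _); have := hd x (mem_head _ _).
by case: (P x); case: (Q x); case: (R x) => //=; lia.
Qed.

(* The bound by 2 turns "odd" into "exactly one", the condition in the
   definition of the boundary. *)
Lemma cofaces_bd d :
  [/\ forall s r, odd (d + s) -> (d < size r)%N ->
        odd (count (ballw d s) (cofaces r)) = bdw d s r
        /\ (count (ballw d s) (cofaces r) <= 2)%N &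
      forall s r, odd (d + s) -> (d < size r)%N ->
        ~~ odd (count (bdw d s) (cofaces r))
        /\ (count (bdw d s) (cofaces r) <= 2)%N].
Proof.
elim: d => [|d [IHb IHdb]].
  have cz : forall r, count (all (pred1 (None : option bool))) (cofaces r) = 0.
    elim=> // -[b|] r IH.
      by rewrite count_cofaces_some (@eq_count _ _ pred0) // count_pred0.
    by rewrite count_cofaces_zero.
  have cb : forall r, (0 < size r)%N -> count point_b (cofaces r) = all (pred1 None) r.
    elim=> // -[b|] [|a r] IH _ //.
    - rewrite count_cofaces_some (@eq_in_count _ _ pred0) ?count_pred0 //.
      by move=> [|a' w] // /size_cofaces.
    rewrite count_cofaces_zero; rewrite -[RHS]/(all (pred1 None) (a :: r) : nat) -IH //.
    rewrite add0n; apply: eq_in_count => -[|a' w] // /size_cofaces //.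
  split=> s r _ sz.
    rewrite bdw0E (eq_count (a2 := fun w => (s == 1) && point_b w)) //.
    case: (s == 1) => /=; last by rewrite (eq_count (a2 := pred0)) // count_pred0.
    by rewrite (eq_count (a2 := point_b)) // cb //; case: all.
  rewrite (eq_count (a2 := fun w => (s == 1) && all (pred1 None) w)) //.
  case: (s == 1) => /=; last by rewrite (eq_count (a2 := pred0)) // count_pred0.
  by rewrite (eq_count (a2 := all (pred1 None))) // cz.
have dd e : d.+1 + e.+1 = (d + e).+2 by lia.
have Bp s r : odd (d.+1 + s.+1) -> (d.+1 < size r)%N ->
        odd (count (ballw d.+1 s.+1) (cofaces r)) = bdw d.+1 s.+1 r
        /\ (count (ballw d.+1 s.+1) (cofaces r) <= 2)%N.
  rewrite dd /= negbK; case: r => [|[[]|] r] //= os; rewrite ltnS => sz.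
  - by rewrite count_map; apply: IHb.
  - rewrite count_map -[count _ _]/(count (fun w => ballw d s.+2 (wneg w)) (cofaces r)).
    rewrite count_cofaces_neg; apply: IHb; rewrite ?size_wneg //.
    by rewrite !addnS /= negbK.
  rewrite count_map ballw_pos ballw_neg (@eq_count _ (preim _ _) pred0) // count_pred0 bdw_zero.
  by case: (ballw d s r); case: (ballw d s.+2 (wneg r)).
have sub s w : odd (d + s) -> (d < size w)%N -> ballw d s.+2 (wneg w) -> ballw d s w.
  exact: ballw_wneg_sub.
have DBp s r : odd (d.+1 + s.+1) -> (d.+1 < size r)%N ->
        ~~ odd (count (bdw d.+1 s.+1) (cofaces r))
        /\ (count (bdw d.+1 s.+1) (cofaces r) <= 2)%N.
  rewrite dd /= negbK; case: r => [|[[]|] r] //= os; rewrite ltnS => sz.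
  - by rewrite count_map; apply: IHdb.
  - rewrite count_map -[count _ _]/(count (fun w => bdw d s.+2 (wneg w)) (cofaces r)).
    rewrite count_cofaces_neg; apply: IHdb; rewrite ?size_wneg //.
    by rewrite !addnS /= negbK.
  rewrite count_map bdw_pos bdw_neg.
  rewrite -[count _ (cofaces r)]/(count (fun w => ballw d s w (+) ballw d s.+2 (wneg w)) (cofaces r)).
  have os2 : odd (d + s.+2) by rewrite !addnS /= negbK.
  have [p1 b1] := IHb s r os sz.
  have := IHb s.+2 (wneg r) os2; rewrite size_wneg -count_cofaces_neg => /(_ sz) [p2 b2].
  have [e l] := @count_addb_sub _ (ballw d s) (fun w => ballw d s.+2 (wneg w)) (cofaces r)
    (fun w hw => sub s w os (eq_ind_r (fun n => (d < n)%N) sz (size_cofaces hw))).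
  (* The two words filling the head contribute the parities of [x] and [y], the others contribute
     [x - y]; for [y <= x <= 2] the total is always 0 or 2. *)
  rewrite -p1 -p2 e; move: b1 b2 l.
  move: (count (ballw d s) _) (count (fun w => ballw d s.+2 (wneg w)) _) => x y.
  by move: x y => [|[|[|x]]] [|[|[|y]]].
have Df r : odd d.+1 -> (d.+1 < size r)%N ->
    ~~ odd (count (sphw d.+1) (cofaces r)) /\ (count (sphw d.+1) (cofaces r) <= 2)%N.
  move=> od; elim: r => // a r IH; rewrite /= ltnS leq_eqVlt => /orP[/eqP sz|sz].
    rewrite -/(cofaces (a :: r)) (@eq_in_count _ _ (all isSome)); last first.
      move=> w hw; rewrite sphw_small ?(size_cofaces hw) /= -?sz // eqxx //.
    elim: (a :: r) => {a r sz IH} // -[e|] r IH; first by rewrite count_cofaces_some.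
    rewrite count_cofaces_zero /= (@eq_count _ _ pred0) // count_pred0.
    by case: all.
  have o2 : odd (d.+1 + 2) by rewrite addn2 /= negbK.
  rewrite -/(cofaces (a :: r)); case: a => [[]|].
  - rewrite count_cofaces_some (@eq_in_count _ _ (bdw d.+1 2)); first exact: DBp.
    by move=> w /size_cofaces hw; rewrite sphw_pos // hw.
  - rewrite count_cofaces_some (@eq_in_count _ _ (fun w => bdw d.+1 2 (wneg w))); last first.
      by move=> w /size_cofaces hw; rewrite sphw_neg // hw.
    by rewrite count_cofaces_neg; apply: DBp; rewrite ?size_wneg.
  rewrite count_cofaces_zero sphw_pos // sphw_neg //.
  have [p1 b1] := Bp 1 r o2 sz.
  have := Bp 1 (wneg r) o2; rewrite size_wneg -count_cofaces_neg => /(_ sz) [p2 b2].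
  have [p0 b0] := IH sz.
  rewrite -p1 -p2.
  have Dsub w : w \in cofaces r -> (d.+1 < size w)%N by move/size_cofaces->.
  have := @count_excl _ (sphw d.+1) (ballw d.+1 2) (fun w => ballw d.+1 2 (wneg w)) (cofaces r).
  have -> : count (fun w => sphw d.+1 (None :: w)) (cofaces r) =
    count (fun w => [&& sphw d.+1 w, ~~ ballw d.+1 2 w & ~~ ballw d.+1 2 (wneg w)]) (cofaces r).
    by apply: eq_in_count => w /Dsub hw; rewrite sphw_zero.
  have h1 : {in cofaces r, forall x, ballw d.+1 2 x -> sphw d.+1 x}.
    by move=> w /Dsub hw; apply: sphw_ballw.
  have h2 : {in cofaces r, forall x, ballw d.+1 2 (wneg x) -> sphw d.+1 x}.
    by move=> w /Dsub hw h; rewrite -sphw_wneg sphw_ballw ?size_wneg.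
  have h3 : {in cofaces r, forall x, ballw d.+1 2 (wneg x) -> ~~ ballw d.+1 2 x}.
    by move=> w /Dsub hw; apply: ballw_wneg_disj.
  move/(_ h1 h2 h3); move: p0 b0 b1 b2.
  move: (count _ _) (count (sphw d.+1) _) (count (ballw d.+1 2) _) (count (fun w => ballw d.+1 2 (wneg w)) _).
  by move=> [|[|[|t]]] [|[|[|x]]] // [|[|[|y]]] // [|[|[|z]]].
have Bf s r : odd (d.+1 + s) -> (d.+1 < size r)%N ->
        odd (count (ballw d.+1 s) (cofaces r)) = bdw d.+1 s r
        /\ (count (ballw d.+1 s) (cofaces r) <= 2)%N.
  case: s => [|s]; last exact: Bp.
  rewrite addn0 => od sz; have [p0 b0] := Df r od sz.
  have [||p1 b1] := Bp 1 r => //; first by rewrite addn2 /= negbK.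
  have := @count_excl _ (sphw d.+1) (ballw d.+1 2) pred0 (cofaces r).
  have -> : count (fun w => [&& sphw d.+1 w, ~~ ballw d.+1 2 w & ~~ pred0 w]) (cofaces r)
    = count (ballw d.+1 0) (cofaces r).
    by apply: eq_count => w; rewrite /= andbT ballw_compl.
  rewrite count_pred0 addn0 bdw_compl -p1 => /(_ _ (fun _ _ (h : false) => False_ind _ (notF h)) (fun _ _ (h : false) => False_ind _ (notF h))) h.
  have {}h := h (fun w hw => sphw_ballw od (eq_ind_r (fun n => (d.+1 < n)%N) sz (size_cofaces hw))).
  move: p0 b0 b1 h.
  move: (count _ _) (count (sphw d.+1) _) (count (ballw d.+1 2) _).
  by move=> [|[|[|x]]] [|[|[|y]]] // [|[|[|z]]].
split=> // -[|s] r; last exact: DBp.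
rewrite addn0 => od sz; rewrite (@eq_count _ _ (bdw d.+1 2)) //.
by apply: DBp; rewrite ?addn2 //= negbK.
Qed.

Lemma count_cofaces_ballw d s r : odd (d + s) -> (d < size r)%N ->
  bdw d s r = (count (ballw d s) (cofaces r) == 1).
Proof.
move=> od sz; have [h _] := cofaces_bd d; have [<-] := h s r od sz.
by case: (count _ _) => [|[|[|x]]].
Qed.

(** By [bdw_sphere] the sphere is a boundary, for which the bound is known; length [d + 1], the
    cross-polytope, is treated directly. *)
Lemma count_cofaces_sphw d r : odd d -> (d < size r)%N ->
  (count (sphw d) (cofaces r) <= 2)%N.
Proof.
move=> od sz; case: (ltnP d.+1 (size r)) => h.
  have [_ hb] := cofaces_bd d.+1; have [] := hb 1 r => //=; first by rewrite addn1 /= od.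
  by move=> _; rewrite (@eq_in_count _ _ (sphw d)) // => w /size_cofaces hw; rewrite bdw_sphere ?hw.
rewrite (@eq_in_count _ _ (all isSome)); last first.
  by move=> w hw; rewrite sphw_small (size_cofaces hw) // eqn_leq h sz.
elim: r {sz h} => // -[e|] r IH; first by rewrite count_cofaces_some.
rewrite count_cofaces_zero /= (@eq_count _ _ pred0) // count_pred0.
by case: all.
Qed.

(** * Top letters of a facet *)

(** The link of the edge [{n, n-1}]: reading two positive letters leads to the boundary of a ball at
    level 1, which is a sphere. *)
Lemma sphw_pp d w : odd d -> (d.+1 < size w)%N ->
  sphw d.+2 [:: Some true, Some true & w] = sphw d w.
Proof. by move=> od sz; rewrite sphw_pos //= bdw_pos bdw_sphere. Qed.

Lemma ballw_trans d s w : odd (d + s) -> (d < size w)%N -> ballw d s.+4 w -> ballw d s w.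
Proof.
move=> od sz h; apply: ballw_wneg_sub => //; apply: ballw_wneg_sub; rewrite ?wnegK ?size_wneg //.
by rewrite !addnS /= negbK.
Qed.

(** The sum modulo 2 is that of the complementary ball and the ball at level 4, which is contained
    in it by [ballw_trans]. *)
Lemma sphw_p0p d w : odd d -> (d < size w)%N ->
  sphw d.+2 [:: Some true, None, Some true & w]
    = [&& sphw d w, ~~ ballw d 2 w & ~~ ballw d 4 w].
Proof.
case: d => // d od sz; rewrite sphw_pos // bdw_zero ballw_pos /= ballw_neg wnegK.
have := @ballw_trans d.+1 0 w; rewrite addn0 => /(_ od sz).
rewrite ballw_compl andbA; case: (ballw _ 4 _) => [/(_ isT)|_]; last by rewrite addbF andbT.
by move=> ->.
Qed.

(** Both terms of the sum modulo 2 reduce to the same ball at level 2 and cancel. This cancellation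
    is what makes [n] special. *)
Lemma sphw_p0n d w : (d < size w)%N ->
  sphw d.+2 [:: Some true, None, Some false & w] = false.
Proof. by move=> sz; rewrite sphw_pos // bdw_zero ballw_neg /= ballw_pos addbb. Qed.

Lemma sphw_p00 d w : (d < size w)%N ->
  sphw d.+2 [:: Some true, None, None & w] = false.
Proof. by move=> sz; rewrite sphw_pos // bdw_zero !ballw_zero. Qed.

Lemma sphw_pn0p d w : (d < size w)%N ->
  sphw d.+3 [:: Some true, Some false, None, Some true & w] = false.
Proof. by move=> sz; rewrite sphw_pos //= bdw_neg /= bdw_zero /= ballw_pos ballw_neg addbb. Qed.

Lemma sphw_pn00 d w : (d < size w)%N ->
  sphw d.+3 [:: Some true, Some false, None, None & w] = false.
Proof. by move=> sz; rewrite sphw_pos //= bdw_neg /= bdw_zero /= !ballw_zero. Qed.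

Lemma sphw_pn0n d w : (d < size w)%N ->
  sphw d.+3 [:: Some true, Some false, None, Some false & w]
    = ballw d 1 (wneg w) (+) ballw d 5 (wneg w).
Proof.
by move=> sz; rewrite sphw_pos //= bdw_neg /= bdw_zero /= ballw_neg ballw_pos wnegK.
Qed.

(** The words of the replaced balls have a nonzero head, so a facet avoiding the top vertices is not
    removed in the next step. *)
Lemma sphw_00 d w : (d < size w)%N -> sphw d [:: None, None & w] = sphw d (None :: w).
Proof. by case: d => [|d] sz; rewrite [LHS]sphw_zero ?ltnS 1?ltnW //= ?ballw_zero ?andbT. Qed.

Lemma sphw_0p0 d w : (d < size w)%N ->
  sphw d.+2 [:: None, Some true, None & w] = sphw d.+2 [:: Some true, None & w].
Proof. by move=> sz; rewrite sphw_zero //= andbT. Qed.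

(** After the letters [Some true] and [Some false], the replaced ball and its antipode are read at
    levels 2 and 4, where no word with head [None] is accepted. *)
Lemma sphw_0pn0 d w : (d < size w)%N ->
  sphw d.+2 [:: None, Some true, Some false, None & w]
   = sphw d.+2 [:: Some true, Some false, None & w].
Proof.
by move=> sz; rewrite sphw_zero /= ?ltnS 1?ltnW //; case: d {sz} => [|d]; rewrite /= andbT.
Qed.

(** * Words as sets of integers *)

Local Open Scope fset_scope.

Definition signed (e : bool) (n : nat) : int := if e then Posz n else (- Posz n)%R.

Fixpoint wset (w : word) : {fset int} :=
  match w with
  | [::] => fset0
  | Some e :: w' => signed e (size w').+1 |` wset w'
  | None :: w' => wset w'
  end.

Lemma wset_cons a w :
  wset (a :: w) = (if a is Some e then [fset signed e (size w).+1] else fset0) `|` wset w.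
Proof. by case: a => //=; rewrite fset0U. Qed.

Lemma abs_signed e n : absz (signed e n) = n.
Proof. by case: e => /=; rewrite ?abszN. Qed.

Lemma signedN e n : (- signed e n)%R = signed (~~ e) n.
Proof. by case: e => //=; rewrite opprK. Qed.

Lemma signed_inj e e' n : (0 < n)%N -> signed e n = signed e' n -> e = e'.
Proof. by case: e e' => [] [] //=; lia. Qed.

Lemma signedP (v : int) : exists e, v = signed e (absz v).
Proof. by case: (lerP 0 v) => h; [exists true|exists false] => /=; lia. Qed.

Lemma wset_bound w v : v \in wset w -> (0 < absz v <= size w)%N.
Proof.
elim: w => [|a w IH]; first by rewrite inE.
rewrite wset_cons inE => /orP[|/IH] /=; last by lia.
by case: a => [e|] /=; rewrite !inE // => /eqP ->; rewrite abs_signed; lia.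
Qed.

Lemma wset_opp w v : v \in wset w -> (- v)%R \notin wset w.
Proof.
elim: w => [|a w IH]; first by rewrite inE.
rewrite wset_cons !inE => /orP[|h].
  case: a => [e|] /=; rewrite !inE // => /eqP ->; rewrite signedN negb_or.
  apply/andP; split; first by apply/eqP => /signed_inj; case: e => h; have := h isT.
  by apply/negP => /wset_bound; rewrite abs_signed; lia.
rewrite negb_or IH // andbT; case: a => [e|] /=; rewrite ?inE //.
by apply/eqP => e1; have := wset_bound h; rewrite -abszN e1 abs_signed; lia.
Qed.

Lemma wset_top w a e : (signed e (size w).+1 \in wset (a :: w)) = (a == Some e).
Proof.
rewrite wset_cons inE; have -> : (signed e (size w).+1 \in wset w) = false.
  by apply/negP => /wset_bound; rewrite abs_signed; lia.
rewrite orbF; case: a => [e'|] /=; rewrite !inE //.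
by apply/eqP/eqP => [/signed_inj -> //|[->]].
Qed.

Lemma wset_low w a v : (absz v <= size w)%N -> (v \in wset (a :: w)) = (v \in wset w).
Proof.
move=> h; rewrite wset_cons inE; case: a => [e|] //; rewrite !inE.
by case: eqP => // e1; move: h; rewrite e1 abs_signed; lia.
Qed.

Lemma wset_sub_cons a b r w : size r = size w ->
  (wset (a :: r) `<=` wset (b :: w)) = ((a == None) || (a == b)) && (wset r `<=` wset w).
Proof.
move=> sz; apply/idP/andP => [/fsubsetP h|[h1 h2]].
  split.
    case: a h => [e|] // h; have := h (signed e (size r).+1); rewrite wset_top eqxx => /(_ isT).
    by rewrite sz wset_top eq_sym.
  apply/fsubsetP => v hv; have hb := wset_bound hv.
  by have := h v; rewrite !wset_low -?sz ?hv; [apply|lia|lia].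
rewrite !wset_cons fsetUSS // sz.
by move/orP: h1 => [/eqP ->|/eqP ->].
Qed.

Lemma card_wset w : #|` wset w| = nz w.
Proof.
elim: w => [|a w IH]; first by rewrite cardfs0.
case: a => [e|] //=; rewrite cardfsU1 IH.
have -> : signed e (size w).+1 \notin wset w => //.
by apply/negP => /wset_bound; rewrite abs_signed; lia.
Qed.

Lemma wset_inj w w' : size w = size w' -> wset w = wset w' -> w = w'.
Proof.
elim: w w' => [|a w IH] [|b w'] //= [sz] e.
have h1 : wset (a :: w) `<=` wset (b :: w') by rewrite -/(wset (b :: w')) [wset (b :: w')]/= -e.
have h2 : wset (b :: w') `<=` wset (a :: w) by rewrite [wset (b :: w')]/= -e.
move: h1 h2; rewrite !wset_sub_cons // => /andP[a1 s1] /andP[a2 s2].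
rewrite (IH w') //; last by apply/eqP; rewrite eqEfsubset s1.
by case: a a1 a2 {e} => [a|]; case: b => [b|] //= /eqP[->].
Qed.

Lemma mem_cofaces r w :
  (w \in cofaces r) = [&& size w == size r, wset r `<=` wset w & nz w == (nz r).+1].
Proof.
elim: r w => [|a r IH] w.
  by rewrite /=; case: w => [|b w] //=; rewrite andbF.
case: (size w =P size (a :: r)) => [|sz]; last by apply/negP => /size_cofaces.
case: w => [|b w] //= [sz]; rewrite -/(wset (a :: r)) -/(wset (b :: w)).
rewrite wset_sub_cons // mem_cat.
have nzw : wset r `<=` wset w -> nz w = nz r -> w = r.
  move=> h1 h2; apply: wset_inj => //; apply/esym/eqP; rewrite eqEfcard h1.
  by rewrite !card_wset h2 leqnn.
have mapE c : ((b :: w) \in map (cons c) (cofaces r)) = (b == c) && (w \in cofaces r).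
  apply/mapP/andP => [[u hu [-> ->]]|[/eqP -> h]]; first by rewrite eqxx.
  by exists w.
rewrite mapE IH sz eqxx /= /nz /= -/(nz w) -/(nz r).
case: a => [e|]; case: b {mapE} => [f|] //=; rewrite ?add1n ?add0n ?eqSS ?eqxx ?orbF /=.
- by rewrite [Some e == _]eq_sym andbA.
- have -> : (Some f :: w \in [:: Some true :: r; Some false :: r]) = (w == r).
    by rewrite !inE !eqseq_cons; case: f => /=; rewrite ?orbF.
  apply/eqP/andP => [->|[h1 /eqP h2]]; first by rewrite fsubset_refl eqxx.
  exact: nzw.
Qed.

Lemma cofaces_uniq r : uniq (cofaces r).
Proof.
elim: r => //= a r IH; rewrite cat_uniq map_inj_uniq ?IH; last by move=> x y [].
rewrite andbT; apply/andP; split; first by case: a => //=; rewrite inE eqseq_cons.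
apply/hasPn => u /mapP[w hw ->]; case: a => //=; rewrite !inE !eqseq_cons //=.
Qed.

Lemma wset_wneg w : wset (wneg w) = neg_set (wset w).
Proof.
elim: w => [|a w IH]; first by apply/fsetP => v; rewrite !inE; apply/esym/imfsetP => -[x]; rewrite inE.
rewrite -[wneg _]/(omap negb a :: wneg w) !wset_cons size_wneg IH; apply/fsetP => v; rewrite inE.
apply/idP/imfsetP => [|[x hx ->]].
  case/orP => [|/imfsetP[x hx ->]]; last by exists x => //=; rewrite inE hx orbT.
  case: a => [e|] /=; rewrite !inE // => /eqP ->; exists (signed e (size w).+1); rewrite ?signedN //=.
  by rewrite !inE eqxx.
move: hx; rewrite /= inE => /orP[|h]; last by apply/orP; right; apply/imfsetP; exists x.
by case: a => [e|] /=; rewrite !inE // => /eqP ->; rewrite signedN eqxx.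
Qed.

Lemma mem_neg_set (s : {fset int}) v : (v \in neg_set s) = ((- v)%R \in s).
Proof.
apply/imfsetP/idP => [[x hx ->]|h]; first by rewrite opprK.
by exists (- v)%R; rewrite ?opprK.
Qed.

Lemma neg_setK : involutive neg_set.
Proof. by move=> s; apply/fsetP => v; rewrite !mem_neg_set opprK. Qed.

Lemma wset_surj n (s : {fset int}) :
  (forall v, v \in s -> (0 < absz v <= n)%N /\ (- v)%R \notin s) ->
  exists2 w, size w = n & wset w = s.
Proof.
elim: n s => [|n IH] s hs.
  by exists [::] => //=; apply/esym/fsetP => v; rewrite inE; apply/negP => /hs; lia.
have [|w sw ww] := IH (s `\` [fset signed true n.+1; signed false n.+1]).
  move=> v; rewrite !inE negb_or => /andP[/andP[/eqP h1 /eqP h2] /hs[h3 h4]]; split.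
    by have [[] e] := signedP v; move: h1 h2 h3; rewrite e abs_signed; move: (absz v) => m /=; lia.
  by rewrite (negbTE h4) andbF.
exists ((if signed true n.+1 \in s then Some true
         else if signed false n.+1 \in s then Some false else None) :: w); first by rewrite /= sw.
have nTF : (signed true n.+1 == signed false n.+1) = false by apply/eqP => /= h; lia.
rewrite wset_cons sw ww; apply/fsetP => v.
case: (boolP (signed true n.+1 \in s)) => hT; [|case: (boolP (signed false n.+1 \in s)) => hF];
  rewrite /= !inE.
- case: (v =P signed true n.+1) => [->|_]; first by rewrite hT.
  case: (v =P signed false n.+1) => [->|_] //=.
  by have [_] := hs _ hT; rewrite signedN => /negbTE ->.
- case: (v =P signed false n.+1) => [->|_]; first by rewrite hF.
  by case: (v =P signed true n.+1) => [->|_] //=; rewrite (negbTE hT).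
case: (v =P signed true n.+1) => [->|_] /=; first by rewrite (negbTE hT).
by case: (v =P signed false n.+1) => [->|_] //=; rewrite (negbTE hF).
Qed.

(** * The complexes of the recursion *)

(** The predicate only describes generators. Together with [uniform], that is purity, these are
    exactly the facets, and [P] decides membership of sets of full size. *)
Definition gens (X : complex) (n : nat) (P : pred word) :=
  forall s, reflect (exists2 w, size w = n & P w /\ s `<=` wset w) (s \in X).

Definition uniform (n c : nat) (P : pred word) :=
  forall w, size w = n -> P w -> nz w = c.

Lemma mem_generated (S : complex) s :
  reflect (exists2 F, F \in S & s `<=` F) (s \in Defs.generated S).
Proof.
apply: (iffP (bigfcupP _ _ _ _)) => [[F]|[F hF hs]].
  by rewrite andbT => hF; rewrite fpowersetE => hs; exists F.
by exists F; rewrite ?andbT ?fpowersetE.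
Qed.

(* [inE] alone would unfold the set [A]. *)
Lemma mem_fset_sep (A : complex) (p : pred {fset int}) F :
  (F \in [fset G in A | p G]) = (F \in A) && p F.
Proof. by rewrite !inE. Qed.

Lemma gens_ext X n P Q : (forall w, size w = n -> P w = Q w) -> gens X n P -> gens X n Q.
Proof.
move=> e h s; apply: (iffP (h s)) => -[w sw [hw ss]]; exists w => //; split=> //.
  by rewrite -e.
by rewrite e.
Qed.

Lemma wset_sub_eq w w' : size w = size w' -> nz w = nz w' -> wset w `<=` wset w' -> w = w'.
Proof.
by move=> h1 h2 h3; apply: wset_inj => //; apply/eqP; rewrite eqEfcard h3 !card_wset h2 leqnn.
Qed.

Lemma gens_mem X n P c w : gens X n P -> uniform n c P -> size w = n -> nz w = c ->
  (wset w \in X) = P w.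
Proof.
move=> g u sw cw; apply/g/idP => [[w' sw' [hw' hs]]|h]; last by exists w.
by rewrite (wset_sub_eq _ _ hs) ?sw ?cw ?(u w').
Qed.

Lemma gens_facets X n P c F : gens X n P -> uniform n c P ->
  reflect (exists2 w, size w = n & P w /\ F = wset w) (F \in facets X).
Proof.
move=> g u; rewrite /facets mem_fset_sep; apply: (iffP andP) => [[/g[w sw [hw hs]] /allP hm]|[w sw [hw ->]]].
  exists w => //; split=> //; apply/eqP; have := hm (wset w); rewrite hs; apply.
  by apply/g; exists w.
split; first by apply/g; exists w.
apply/allP => G /g[w' sw' [hw' hs]]; apply/implyP => h.
have e : w = w' by apply: wset_sub_eq; rewrite ?sw ?(u w) ?(u w') //; apply: fsubset_trans hs.
by rewrite eqEfsubset h e hs.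
Qed.

Lemma gens_cdiff X Y n P Q c : gens X n P -> uniform n c P -> gens Y n Q -> uniform n c Q ->
  gens (cdiff X Y) n (fun w => P w && ~~ Q w).
Proof.
move=> gX uX gY uY s; apply: (iffP (mem_generated _ _)).
  move=> [F]; rewrite mem_fset_sep => /andP[/(gens_facets _ gX uX)[w sw [hw ->]]].
  by rewrite (gens_mem gY uY) ?(uX w) // => nQ hs; exists w; rewrite ?hw ?nQ.
move=> [w sw [/andP[hP nQ] hs]]; exists (wset w) => //; rewrite mem_fset_sep.
rewrite (gens_mem gY uY) ?(uX w) // nQ andbT.
by apply/(gens_facets _ gX uX); exists w.
Qed.

Lemma gens_neg X n P : gens X n P -> gens (neg_complex X) n (fun w => P (wneg w)).
Proof.
move=> g s; apply: (iffP (imfsetP _ _ _ _)) => /=.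
  move=> [t /g[w sw [hw ht]] ->]; exists (wneg w); rewrite ?size_wneg // wnegK; split=> //.
  by rewrite wset_wneg; apply/fsubsetP => v; rewrite !mem_neg_set; apply: (fsubsetP ht).
move=> [w sw [hw hs]]; exists (neg_set s); last by rewrite neg_setK.
apply/g; exists (wneg w); rewrite ?size_wneg //; split=> //.
by rewrite wset_wneg; apply/fsubsetP => v; rewrite !mem_neg_set; apply: (fsubsetP hs).
Qed.

Lemma gens_union X Y n P Q : gens X n P -> gens Y n Q ->
  gens (X `|` Y) n (fun w => P w || Q w).
Proof.
move=> gX gY s; rewrite inE; apply: (iffP orP).
  by case=> [/gX|/gY] [w sw [hw hs]]; exists w => //; rewrite hw ?orbT.
by move=> [w sw [/orP[] hw hs]]; [left; apply/gX|right; apply/gY]; exists w.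
Qed.

Lemma gens_lift X n P : gens X n P ->
  gens X n.+1 (fun w => if w is None :: w' then P w' else false).
Proof.
move=> g s; apply: (iffP (g s)); first by move=> [w sw hw]; exists (None :: w); rewrite /= ?sw.
by move=> [[|[e|] w] //= [sw] [hw hs]] //; exists w.
Qed.

Lemma gens_cone X n P e : gens X n P ->
  gens (cone X (signed e n.+1)) n.+1
    (fun w => if w is a :: w' then (a == Some e) && P w' else false).
Proof.
move=> g s; rewrite /cone /join /simplex; apply: (iffP (imfset2P _ _ _ _ _)) => /=.
  move=> [t /g[w sw [hw ht]] [u]]; rewrite fpowersetE => hu ->.
  exists (Some e :: w); rewrite /= ?sw // eqxx; split=> //.
  by rewrite fsubUset (fsubset_trans ht) ?fsubsetUr // (fsubset_trans hu) // fsubsetUl.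
move=> [[|a w] //= [sw] [/andP[/eqP -> hw] hs]].
exists (s `\ signed e n.+1).
  apply/g; exists w => //; split=> //; apply/fsubsetP => v; rewrite !inE => /andP[h1 h2].
  by have := fsubsetP hs v h2; rewrite sw !inE (negbTE h1).
exists (s `&` [fset signed e n.+1]); first by rewrite fpowersetE fsubsetIr.
apply/fsetP => v; rewrite !inE; case: eqP => [->|_] //=; rewrite ?andbT ?andbF ?orbF //.
Qed.

Lemma gens_boundary X n P c : gens X n P -> uniform n c.+1 P ->
  gens (boundary X) n (fun r => count P (cofaces r) == 1).
Proof.
move=> g u.
(* Through [wset], the facets containing a ridge correspond to the cofaces of its word that satisfy
   [P]. *)
have card r : size r = n -> nz r = c ->
    #|` [fset F in facets X | wset r `<=` F]| = count P (cofaces r).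
  move=> sr cr; rewrite -size_filter -(size_map wset).
  apply/perm_size/uniq_perm; first exact: fset_uniq.
    rewrite map_inj_in_uniq ?filter_uniq ?cofaces_uniq // => x y; rewrite !mem_filter.
    move=> /andP[_ /size_cofaces hx] /andP[_ /size_cofaces hy].
    by apply: wset_inj; rewrite hx hy.
  move=> F; apply/idP/mapP.
    rewrite mem_fset_sep => /andP[/(gens_facets _ g u)[w sw [hw ->]] hs].
    by exists w => //; rewrite mem_filter hw mem_cofaces sw sr eqxx hs (u w) // cr eqxx.
  move=> [w]; rewrite mem_filter mem_cofaces sr => /andP[hw /and3P[/eqP sw hs _]] ->.
  by rewrite mem_fset_sep hs andbT; apply/(gens_facets _ g u); exists w.
move=> s; apply: (iffP (mem_generated _ _)).
  move=> [R]; rewrite mem_fset_sep => /andP[/bigfcupP[F]]; rewrite andbT.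
  move=> /(gens_facets _ g u)[w sw [hw ->]] /imfsetP[v /= hv ->] hc hs.
  have [|r sr er] := @wset_surj n (wset w `\ v).
    move=> x; rewrite !inE => /andP[_ hx]; rewrite (negbTE (wset_opp hx)) andbF; split=> //.
    by rewrite -sw; apply: wset_bound.
  exists r => //; rewrite er; split=> //; rewrite -card ?er //.
  by apply/eqP; rewrite -eqSS -(u w sw hw) -!card_wset er (cardfsD1 v (wset w)) hv.
move=> [r sr [hc hs]]; exists (wset r) => //; rewrite mem_fset_sep.
have : has P (cofaces r) by rewrite has_count (eqP hc).
move=> /hasP[w]; rewrite mem_cofaces => /and3P[/eqP sw hsw /eqP cw] hw.
have cr : nz r = c by have := u w; rewrite sw cw => /(_ sr hw)[].
rewrite card // hc andbT; apply/bigfcupP; exists (wset w).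
  by rewrite andbT; apply/(gens_facets _ g u); exists w; rewrite ?sw.
have : (0 < #|` wset w `\` wset r|)%N by rewrite cardfsDS // !card_wset cw subSnn.
rewrite cardfs_gt0 => /fset0Pn[v]; rewrite inE => /andP[v1 v2].
apply/imfsetP; exists v => //=; apply/eqP; rewrite eqEfcard; apply/andP; split.
  apply/fsubsetP => x hx; rewrite !inE (fsubsetP hsw) // andbT.
  by apply: contraNneq v1 => <-.
by have := cardfsD1 v (wset w); rewrite v2 !card_wset cw => -[->].
Qed.

Lemma mem_V n v : (v \in V n) = (0 < absz v <= n)%N.
Proof.
rewrite inE; apply/orP/idP => [[]|h].
- by move=> /imfsetP[i /=]; rewrite mem_iota => hi ->; lia.
- by move=> /imfsetP[i /=]; rewrite mem_iota => hi ->; lia.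
have [[] e] := signedP v; [left|right]; apply/imfsetP; exists (absz v); rewrite /= ?mem_iota //; lia.
Qed.

Lemma gens_cross m : gens (cross_boundary m) m (all isSome).
Proof.
move=> s; rewrite inE /=; apply: (iffP andP).
  rewrite fpowersetE => -[/fsubsetP hV /allP ha].
  have [|w sw <-] := @wset_surj m s.
    by move=> v hv; rewrite -mem_V hV // ha.
  exists (map (fun a => Some (odflt true a)) w); rewrite ?size_map //; split.
    by rewrite all_map; apply/allP => -[].
  elim: w {sw} => [|a w IH] //; rewrite map_cons wset_sub_cons ?size_map // IH.
  by case: a => [[]|].
move=> [w sw [_ hs]]; split.
  by rewrite fpowersetE; apply/fsubsetP => v /(fsubsetP hs) /wset_bound; rewrite mem_V sw.
apply/allP => v hv; apply: contra (wset_opp (fsubsetP hs v hv)); exact: (fsubsetP hs).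
Qed.

(** * Dimension one: the cycle *)

Lemma wset_nseq m : wset (nseq m None) = fset0.
Proof. by elim: m. Qed.

Lemma all_noneP (w : word) : reflect (w = nseq (size w) None) (all (pred1 (None : option bool)) w).
Proof.
apply: (iffP idP) => [|->]; last by rewrite all_nseq orbT.
by elim: w => //= a w IH /andP[/eqP -> /IH {1}->].
Qed.

Lemma point_bP w : reflect (0 < size w /\ wset w = [fset signed false 1])%N (point_b w).
Proof.
elim: w => [|a w IH]; first by constructor => -[].
case: w IH => [|b w] IH.
  rewrite /=; apply: (iffP eqP) => [->|[_]]; first by rewrite /= fsetU0.
  case: a => [e|] /=; last by move/fsetP/(_ (signed false 1)); rewrite !inE eqxx.
  rewrite fsetU0 => /fsetP/(_ (signed false 1)); rewrite !inE eqxx => /eqP.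
  by case: e => //=; lia.
rewrite -[point_b _]/((a == None) && point_b (b :: w)).
apply: (iffP andP) => [[/eqP -> /IH[_ h]]|[_ h]] //.
have ha : a == None.
  case: a h => [e|] // h; have := wset_top (b :: w) (Some e) e.
  rewrite h eqxx inE => /eqP/(congr1 absz); rewrite !abs_signed //.
by split=> //; apply/IH; split=> //; rewrite -h (eqP ha).
Qed.

Definition cycle_edge (n : nat) (F : {fset int}) :=
  [\/ exists e i, (0 < i < n)%N /\ F = [fset signed e i; signed e i.+1]
    | exists e, F = [fset signed e n; signed (~~ e) 1]].

Lemma ballw1E n w : (size w = n.+1)%N -> (0 < n)%N ->
  ballw 1 2 w = (wset w == [fset signed true n.+1; signed false 1]).
Proof.
case: w => // a w [sw] n0; case: a => [[]|].
- rewrite ballw_pos ballw0E eqxx andTb; apply/point_bP/eqP => [[_ h]|h].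
    by rewrite wset_cons h sw.
  split; first by rewrite sw.
  apply/fsetP => v; rewrite !inE; case: (leqP (absz v) (size w)) => hv.
    rewrite -(wset_low (Some true) hv) h !inE; case: eqP => // e1.
    by move: hv; rewrite e1 abs_signed sw ltnn.
  have -> : (v \in wset w) = false by apply/negP => /wset_bound; lia.
  by apply/esym/eqP => e1; move: hv; rewrite e1 abs_signed; lia.
- rewrite ballw_neg ballw0E; apply/esym/eqP => h.
  have := wset_top w (Some false) false; rewrite h !inE eqxx sw => /orP[] /eqP /=; lia.
rewrite ballw_zero; apply/esym/eqP => h.
by have := wset_top w None true; rewrite h !inE sw eqxx.
Qed.

Lemma neg_set2 e f i j : neg_set [fset signed e i; signed f j] = [fset signed (~~ e) i; signed (~~ f) j].
Proof.
apply/fsetP => v; rewrite mem_neg_set !inE -!signedN.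
by rewrite -[in LHS](inj_eq oppr_inj) -[X in _ || X](inj_eq oppr_inj) !opprK.
Qed.

(** The cycle obeys the replacement recursion as well: passing from [n] to [n + 1] subdivides the
    edges [{n, -1}] and [{-n, 1}] by the new vertices, starting from the 4-cycle for [n = 2]. *)
Lemma sphw1P n w : (1 < n)%N -> size w = n -> reflect (cycle_edge n (wset w)) (sphw 1 w).
Proof.
elim: n w => // n IH w; rewrite ltnS => n0; case: (n =P 1%N) => [->|n1] sw.
  rewrite sphw_small ?sw //=; case: w sw => [|a [|b [|c w]]] // _.
  apply: (iffP idP).
    rewrite /=; case: a => [e|] //; case: b => [f|] //= _; rewrite fsetU0.
    case: (e =P f) => [->|/eqP]; first by left; exists f, 1%N; rewrite fsetUC.
    by move=> h; right; exists e; case: e f h => [] [].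
  move=> h; have : nz [:: a; b] = 2.
    rewrite -card_wset; case: h => [[e [i [hi ->]]]|[e ->]]; rewrite cardfs2.
      by case: eqP => // /(congr1 absz); rewrite !abs_signed; lia.
    by case: eqP => // /(congr1 absz); rewrite !abs_signed; lia.
  by case: a h => [e|] h; case: b h => [f|].
have {n0}n1 : (1 < n)%N by lia.
case: w sw => // a w [sw].
have cyc v F : cycle_edge n F -> v \in F -> (0 < absz v <= n)%N.
  by case=> [[e [i [hi ->]]]|[e ->]]; rewrite !inE => /orP[] /eqP ->; rewrite abs_signed; lia.
have nb e F : cycle_edge n.+1 F -> signed e n.+1 \in F ->
    F = [fset signed e n.+1; signed e n] \/ F = [fset signed e n.+1; signed (~~ e) 1].
  case=> [[f [i [hi ->]]]|[f ->]]; rewrite !inE.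
    case/orP=> /eqP h; have h' := congr1 absz h; rewrite !abs_signed in h'; first by lia.
    left; rewrite -h' in h *; case: h' => h'; rewrite -h' fsetUC.
    by rewrite (signed_inj _ h).
  case/orP=> /eqP h; have h' := congr1 absz h; rewrite !abs_signed in h'; last by lia.
  by right; rewrite (signed_inj _ h).
have top a' e : (signed e n.+1 \in wset (a' :: w)) = (a' == Some e) by rewrite -sw wset_top.
have szw : (1 < size w)%N by rewrite sw.
have some e : reflect (cycle_edge n.+1 (wset (Some e :: w)))
    ((wset w == [fset signed e n]) || (wset w == [fset signed (~~ e) 1])).
  apply: (iffP orP).
    by case=> /eqP h; rewrite /= sw h; [left; exists e, n; rewrite fsetUC; split=> //; lia|right; exists e].
  move=> /(@nb e); rewrite top eqxx /= => /(_ isT).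
  have hn : signed e n.+1 \notin wset w by apply/negP => /wset_bound; rewrite abs_signed; lia.
  rewrite sw => h; have h2 x : signed e n.+1 != x ->
     signed e n.+1 |` wset w = [fset signed e n.+1; x] -> wset w == [fset x].
    move=> hx /fsetP h1; apply/eqP/fsetP => v; have := h1 v; rewrite !inE.
    by case: (v =P signed e n.+1) => [->|] //=; rewrite (negbTE hn) (negbTE hx).
  by case: h => [/h2|/h2] h; [left|right]; apply: h; apply/eqP => /(congr1 absz); rewrite !abs_signed; lia.
have bdw1E u : size u = n -> bdw 1 2 u =
    (wset u == [fset signed true n]) || (wset u == [fset signed false 1]).
  case: u => [|b u] su; first by move: n1; rewrite -su.
  rewrite -su; case: b su => [[]|] su.
  - rewrite bdw_pos bdw0E eqxx /=; apply/idP/orP => [/all_noneP ->|]; first by rewrite wset_nseq size_nseq fsetU0 eqxx; left.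
    case=> /eqP/fsetP h.
      apply/all_noneP/wset_inj; rewrite ?size_nseq // wset_nseq; apply/fsetP => v; rewrite inE.
      apply/negP => hv; have := h v; rewrite !inE hv orbT => /esym/eqP e1.
      by have := wset_bound hv; rewrite e1 ?abs_signed; lia.
    have := h (signed true (size u).+1); rewrite !inE eqxx => /esym/eqP /=; lia.
  - rewrite bdw_neg bdw0E /=; apply/esym/negP => /orP[] /eqP /fsetP /(_ (signed false (size u).+1));
      rewrite !inE eqxx => /esym/eqP /=; move: su => /= su; lia.
  rewrite bdw_zero ballw0E /= addbF; apply/point_bP/orP => [[_ ->]|]; first by rewrite eqxx; right.
  case=> /eqP h; last by split=> //; move: su => /=; lia.
  have := wset_top u None true; rewrite /= h !inE /= eqxx //.
case: a => [[]|].
- by rewrite sphw_pos // bdw1E //; apply: some.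
- rewrite sphw_neg // bdw1E ?size_wneg // wset_wneg.
  have ne x e m : (neg_set x == [fset signed e m]) = (x == [fset signed (~~ e) m]).
    rewrite -(inj_eq (can_inj neg_setK)) neg_setK; congr (x == _).
    by apply/fsetP => v; rewrite mem_neg_set !inE -signedN -[in LHS](inj_eq oppr_inj) opprK.
  by rewrite !ne; apply: some.
rewrite sphw_zero // !(@ballw1E n.-1) ?size_wneg ?prednK //; try lia.
have -> : (wset (wneg w) == [fset signed true n; signed false 1]) =
          (wset w == [fset signed false n; signed true 1]).
  by rewrite wset_wneg -(inj_eq (can_inj neg_setK)) neg_setK neg_set2.
have sg e i x : x \in [fset signed e i.+1; signed e i.+2] -> exists m, x = signed e m.+1.
  by rewrite !inE => /orP[] /eqP ->; [exists i|exists i.+1].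
apply: (iffP and3P).
  move=> [/(IH _ n1 sw) [[e [i [hi h]]]|[[] h]]]; last 2 first.
  - by rewrite h eqxx.
  - by rewrite h eqxx.
  by left; exists e, i; split=> //; lia.
have hn e : signed e n.+1 \notin wset w by apply/negP => /wset_bound; rewrite abs_signed; lia.
move=> /= [[e [i [hi h]]]|[e h]]; last by have := hn e; rewrite h !inE eqxx.
have in' : (i < n)%N.
  rewrite ltn_neqAle -ltnS; have [_ ->] := andP hi; rewrite andbT; apply/eqP => e1.
  by have := hn e; rewrite h e1 !inE eqxx orbT.
split; first by apply/IH => //; left; exists e, i; split=> //; lia.
  apply/eqP => h1; have := h1; rewrite h -(prednK (_ : 0 < i)%N); last by lia.
  move=> h2; have := @sg e i.-1 (signed true n); rewrite h2 !inE eqxx => /(_ isT)[m hm].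
  have := @sg e i.-1 (signed false 1); rewrite h2 !inE eqxx orbT => /(_ isT)[m' hm'].
  by case: e {h h1 h2} hm hm' => /=; lia.
apply/eqP => h1; have := h1; rewrite h -(prednK (_ : 0 < i)%N); last by lia.
move=> h2; have := @sg e i.-1 (signed false n); rewrite h2 !inE eqxx => /(_ isT)[m hm].
have := @sg e i.-1 (signed true 1); rewrite h2 !inE eqxx orbT => /(_ isT)[m' hm'].
by case: e {h h1 h2} hm hm' => /=; lia.
Qed.

Lemma wset_of_cycle_edge n F : (1 < n)%N -> cycle_edge n F -> exists2 w, size w = n & wset w = F.
Proof.
move=> n0 h; apply: wset_surj => v.
case: h => [[e [i [hi ->]]]|[e ->]]; rewrite !inE => /orP[] /eqP ->; rewrite abs_signed signedN negb_or;
  split; try lia; apply/andP; split; apply/eqP; case: e => /=; lia.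
Qed.

Lemma mem_zip_behead (T : eqType) (x0 : T) (p : seq T) e :
  reflect (exists2 i, (i.+1 < size p)%N & e = (nth x0 p i, nth x0 p i.+1))
          (e \in zip p (behead p)).
Proof.
have sz : size (zip p (behead p)) = (size p).-1 by rewrite size_zip size_behead; lia.
apply: (iffP (nthP (x0, x0))) => -[i hi].
  rewrite nth_zip_cond hi nth_behead => <-; exists i => //.
  by move: hi; rewrite sz; case: (size p).
move=> ->; have h : (i < size (zip p (behead p)))%N by rewrite sz; case: (size p) hi.
by exists i; rewrite // nth_zip_cond nth_behead h.
Qed.

Lemma nth_cycle n i : (0 < n)%N -> (i <= n.*2)%N ->
  nth (0 : int)%R ([seq Posz i | i <- iota 1 n] ++ [seq (- Posz i)%R | i <- iota 1 n] ++ [:: (1 : int)%R]) i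
  = if (i < n)%N then signed true i.+1
    else if (i < n.*2)%N then signed false (i - n).+1 else signed true 1.
Proof.
move=> n0 hi; rewrite !nth_cat !size_map !size_iota.
case: ltnP => h1; first by rewrite (nth_map 0%N) ?size_iota // nth_iota.
case: ltnP => h2.
  rewrite (nth_map 0%N) ?size_iota // nth_iota //; have -> // : (i < n.*2)%N by lia.
have -> : (i < n.*2)%N = false by lia.
by have -> : i - n - n = 0%N by lia.
Qed.

Lemma gens_Delta1 n : (1 < n)%N -> gens (Delta1 n) n (sphw 1).
Proof.
move=> n1 s; set p := ([seq Posz i | i <- iota 1 n] ++ [seq (- Posz i)%R | i <- iota 1 n] ++ [:: (1 : int)%R]).
have sp : size p = n.*2.+1 by rewrite !size_cat !size_map !size_iota /=; lia.
have hp i := @nth_cycle n i (ltnW n1).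
apply: (iffP (mem_generated _ _)).
  move=> [F] /imfsetP[e /= /(mem_zip_behead 0%R)[i]]; rewrite -/p sp => hi he -> hs.
  have ce : cycle_edge n [fset e.1; e.2].
    rewrite he /= !hp; [|lia|lia].
    case: (ltngtP i.+1 n) => hin.
    - by left; exists true, i.+1.
    - have hi2 : (i < n.*2)%N by lia.
      rewrite hi2; case: ifP => h3.
        by left; exists false, (i - n).+1; rewrite subSn //; split=> //; lia.
      by right; exists false; rewrite (_ : (i - n).+1 = n) //; lia.
    have h1 : (i.+1 < n.*2)%N by lia.
    by right; exists true; rewrite h1 (_ : i.+1 - n = 0)%N ?hin ?subnn.
  have [w sw hw] := wset_of_cycle_edge n1 ce.
  exists w => //; rewrite hw; split=> //; apply/(sphw1P n1) => //; by rewrite hw.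
move=> [w sw [/(sphw1P n1 sw) h hs]]; exists (wset w) => //.
have aux i : (i < n.*2)%N -> wset w = [fset nth 0%R p i; nth 0%R p i.+1] ->
    wset w \in [fset [fset e.1; e.2] | e in zip p (behead p)].
  move=> hi ->; apply/imfsetP; exists (nth 0%R p i, nth 0%R p i.+1) => //=.
  by apply/mem_zip_behead; exists i => //; rewrite sp.
case: h => [[e [[|i] [hi h]]]|[e h]] //; case: e h => h.
- apply: (aux i); first by lia.
  have i1 : (i < n)%N by lia.
  have i2 : (i.+1 < n)%N by lia.
  by rewrite h !hp; [rewrite i1 i2|lia|lia].
- apply: (aux (n + i)%N); first by lia.
  have i1 : (n + i < n)%N = false by lia.
  have i2 : (n + i < n.*2)%N by lia.
  have i3 : ((n + i).+1 < n)%N = false by lia.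
  have i4 : ((n + i).+1 < n.*2)%N by lia.
  have i5 : (n + i).+1 - n = i.+1 by lia.
  by rewrite h !hp; [rewrite i1 i2 i3 i4 i5 addKn|lia|lia].
- apply: (aux n.-1); first by lia.
  have i1 : (n.-1 < n)%N by lia.
  have i2 : (n < n.*2)%N by lia.
  have n2 : n.-1.+1 = n by lia.
  by rewrite n2 in h *; rewrite h !hp; [rewrite i1 n2 ltnn i2 subnn|lia|lia].
apply: (aux n.*2.-1); first by lia.
have i1 : (n.*2.-1 < n)%N = false by lia.
have i2 : (n.*2.-1 < n.*2)%N by lia.
have i3 : (n.*2 < n)%N = false by lia.
have i4 : n.*2.-1.+1 = n.*2 by lia.
have i5 : (n.*2.-1 - n).+1 = n by lia.
by rewrite i4 h !hp; [rewrite i1 i2 i3 ltnn i5|lia|lia].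
Qed.

Lemma gens_ball1 n : (1 < n)%N -> gens (simplex [fset (-1)%R; Posz n]) n (ballw 1 2).
Proof.
case: n => // n n0 s; rewrite /simplex fpowersetE; apply: (iffP idP) => [hs|[w sw []]].
  have [|w sw hw] := @wset_of_cycle_edge n.+1 [fset signed true n.+1; signed false 1] n0; first by right; exists true.
  exists w => //; rewrite (ballw1E sw) // hw eqxx; split=> //.
  by rewrite fsetUC.
by rewrite (ballw1E sw) // => /eqP ->; rewrite fsetUC.
Qed.

(** * Agreement of words and complexes in all dimensions *)

Lemma gens0 n P : (forall w, size w = n -> P w = false) -> gens fset0 n P.
Proof.
move=> h s; rewrite inE; apply: (iffP idP) => // -[w sw [hw _]].
by rewrite h in hw.
Qed.

Lemma ballw_high d s w : (d.+1 < s)%N -> ballw d s w = false.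
Proof.
elim: d s w => [|d IH] s w; first by rewrite ballw0E; case: s => [|[|s]].
case: s => // s; rewrite ltnS => h; case: w => [|[[]|] w]; rewrite ?ballw_nil // ?ballw_pos ?ballw_neg ?ballw_zero ?IH //.
by lia.
Qed.

Lemma uniform_ballw n d s : uniform n d.+1 (ballw d s).
Proof. by move=> w _; apply: nz_ballw. Qed.
Lemma uniform_sphw n d : uniform n d.+1 (sphw d).
Proof. by move=> w _; apply: nz_sphw. Qed.

Lemma gens_Delta_step X B n d : odd d -> (d < n)%N ->
  gens X n (sphw d) -> gens B n (ballw d 2) ->
  gens (replace (replace X B (Posz n.+1)) (neg_complex B) (- Posz n.+1)%R) n.+1 (sphw d).
Proof.
move=> od dn gX gB; rewrite /replace.
have o2 : odd (d + 2) by rewrite addn2 /= negbK.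
have db r : size r = n -> (count (ballw d 2) (cofaces r) == 1) = bdw d 2 r.
  by move=> sr; rewrite (count_cofaces_ballw o2) ?sr.
have g1 := gens_lift (gens_cdiff gX (@uniform_sphw n d) gB (@uniform_ballw n d 2)).
have g2 := gens_cone true (gens_boundary gB (@uniform_ballw n d 2)).
have gNB := gens_neg gB.
have uNB : uniform n d.+1 (fun w => ballw d 2 (wneg w)).
  by move=> w _; rewrite -(nz_wneg w); apply: nz_ballw.
(* This predicate describes the intermediate complex, after the replacement of [B] and before that
   of [-B]. *)
have uY : uniform n.+1 d.+1 (fun w => match w with None :: w' => sphw d w' && ~~ ballw d 2 w'
     | Some true :: w' => bdw d 2 w' | _ => false end).
  move=> [|[[]|] w] // [sw]; first by move/nz_bdw; rewrite /nz /= => ->.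
  by case/andP=> /nz_sphw.
have gY := gens_ext (Q := fun w => match w with None :: w' => sphw d w' && ~~ ballw d 2 w'
     | Some true :: w' => bdw d 2 w' | _ => false end) _ (gens_union g1 g2).
have {}gY := gY _.
have {gY}gY : gens (cdiff X B `|` cone (boundary B) n.+1) n.+1
  (fun w => match w with None :: w' => sphw d w' && ~~ ballw d 2 w'
     | Some true :: w' => bdw d 2 w' | _ => false end).
  by apply: gY => -[|[[]|] w] //= [sw]; rewrite ?db ?orbF.
have uNB1 : uniform n.+1 d.+1 (fun w => if w is None :: w' then ballw d 2 (wneg w') else false).
  by move=> [|[e|] w] // [sw] h; have := uNB w sw h.
have g3 := gens_cdiff gY uY (gens_lift gNB) uNB1.
have g4 := gens_cone false (gens_boundary gNB uNB).
apply: (gens_ext _ (gens_union g3 g4)) => -[|[[]|] w] //= [sw].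
- by rewrite sphw_pos ?sw // orbF andbT.
- by rewrite sphw_neg ?sw // count_cofaces_neg db ?size_wneg.
by rewrite sphw_zero ?sw // orbF andbA.
Qed.

(** The balls are a hypothesis because [gens_ball] in turn needs the spheres of the same dimension,
    for the complementary balls. *)
Lemma gens_Delta_of k n : (k.*2.+1 < n)%N ->
  (forall m, (k.*2.+1 < m)%N -> gens (ball k.*2.+1 (Posz k) m) m (ballw k.*2.+1 2)) ->
  gens (Delta k.*2.+1 n) n (sphw k.*2.+1).
Proof.
case: k => [|k]; first by move=> n1 _; rewrite Delta_1; apply: gens_Delta1.
set d := k.+1.*2.+1 => dn hb.
elim: n dn => // n IH; rewrite ltnS => dn'; case: (d =P n) => [<-|dn].
  rewrite Delta_cross //; apply: gens_ext (gens_cross _) => w sw.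
  by rewrite sphw_small sw ?eqxx.
have {dn'}dn : (d < n)%N by lia.
rewrite Delta_rec ?dn // (_ : (Posz (uphalf d) - 1)%R = Posz k.+1); last first.
  by rewrite /d /= doubleK; lia.
apply: gens_Delta_step => //; [by rewrite /d /= odd_double|exact: IH|exact: hb].
Qed.

(** Within one dimension the order is that of the definition: the balls at positive level ([low]),
    then the sphere, then the complementary ball ([compl]). A negative [i] is allowed and yields a
    level above [d + 1], where there are no words. *)
Lemma gens_ball d (i : int) s n : (0 < d)%N -> (d < n)%N ->
  (Posz s = Posz d.+1 - (i + i))%R -> gens (ball d i n) n (ballw d s).
Proof.
elim: d i s n => // d IH i s n _ dn hs.
have compl j : (0 < j)%N -> d.+1 = j.*2.-1 -> s = 0%N -> i = Posz j ->
    gens (ball d.+1 (Posz j - 1)%R n) n (ballw d.+1 2) ->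
    gens (Delta d.+1 n) n (sphw d.+1) -> gens (ball d.+1 i n) n (ballw d.+1 s).
  move=> j0 e -> -> gb gD; have ed : d.+1 = (2 * j - 1)%N by rewrite e; lia.
  rewrite ed ball_compl // -ed.
  by apply: gens_ext (gens_cdiff gD (@uniform_sphw _ _) gb (@uniform_ballw _ _ _)) => w sw.
case: d IH dn hs compl => [|d] IH dn hs compl.
  have low n' j t : (1 < n')%N -> (Posz t = 2 - (j + j))%R -> (0 < t)%N -> gens (ball 1 j n') n' (ballw 1 t).
    move=> hn ht t0; case: (j =P 0%R) => [jz|j0].
      rewrite jz ball_1_0 (_ : t = 2%N); last by lia.
      exact: gens_ball1.
    by rewrite ball_neg; [apply: gens0 => w _; apply: ballw_high; lia|lia].
  case: (posnP s) => s0; last by apply: low => //; lia.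
  apply: (compl 1%N) => //; [lia|apply: low => //; lia|exact: gens_Delta1].
have low n' j t : (d.+2 < n')%N -> (Posz t = Posz d.+3 - (j + j))%R -> (0 < t)%N ->
    gens (ball d.+2 j n') n' (ballw d.+2 t).
  case: n' => // n'; rewrite ltnS => hn ht t0; rewrite ball_rec //; last first.
    have := odd_double_half d.+2; lia.
  case: t t0 ht => // t _ ht.
  have g1 := gens_cone true (IH j t n' isT hn _).
  have g2 := gens_cone false (gens_neg (IH (j - 1)%R t.+2 n' isT hn _)).
  have {}g1 := g1 ltac:(lia). have {}g2 := g2 ltac:(lia).
  apply: (gens_ext _ (gens_union g1 g2)) => -[|[[]|] w] //= _.
  by rewrite orbF.
case: (posnP s) => s0; last by apply: low => //; lia.
pose j := absz i; have [ej j0] : i = Posz j /\ (0 < j)%N by rewrite /j; lia.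
have ed : d.+2 = j.-1.*2.+1 by lia.
apply: (compl j) => //; [lia|apply: low => //; lia|].
rewrite ed; apply: gens_Delta_of; first by rewrite -ed.
by move=> m; rewrite -ed => hm; apply: low => //; lia.
Qed.

Lemma gens_Delta k n : (k.*2.+1 < n)%N -> gens (Delta k.*2.+1 n) n (sphw k.*2.+1).
Proof.
move=> hn; apply: gens_Delta_of => // m hm; apply: gens_ball => //; lia.
Qed.

(** * Constructing facets *)

Definition facet (k n : nat) (F : {fset int}) : Prop :=
  exists2 w, size w = n & sphw k.*2.+1 w /\ F = wset w.

(* The facets of dimension 2k+1 on [V m] that survive all later steps. *)
Definition stable_facet (k m : nat) (F : {fset int}) : Prop :=
  exists2 w, size w = m & sphw k.*2.+1 (None :: w) /\ F = wset w.

Lemma odd_d k : odd k.*2.+1. Proof. by rewrite /= odd_double. Qed.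

Lemma sphw_zero_size d w : sphw d (None :: w) -> (d < size w)%N.
Proof. by move=> h; rewrite ltnNge; apply/negP => sz; move: h; rewrite sphw_small //= andbF. Qed.

Lemma facet_bound k n F v : facet k n F -> v \in F -> (0 < absz v <= n)%N.
Proof. by move=> [w <- [_ ->]] /wset_bound. Qed.

Lemma facet_opp k n F v : facet k n F -> v \in F -> (- v)%R \notin F.
Proof. by move=> [w _ [_ ->]] /wset_opp. Qed.

Lemma facet_neg k n F : facet k n F -> facet k n (neg_set F).
Proof.
move=> [w sw [hw ->]]; exists (wneg w); rewrite ?size_wneg //.
by rewrite sphw_wneg wset_wneg.
Qed.

Lemma stable_neg k n F : stable_facet k n F -> stable_facet k n (neg_set F).
Proof.
move=> [w sw [hw ->]]; exists (wneg w); rewrite ?size_wneg //.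
by rewrite wset_wneg -(sphw_wneg _ (None :: wneg w)) /= wnegK.
Qed.

Lemma stable_fac k m F : stable_facet k m F -> facet k m F.
Proof.
move=> [w sw [hw ->]]; exists w => //; split=> //.
by move: hw (sphw_zero_size hw) => + h; rewrite sphw_zero // => /and3P[].
Qed.

Lemma stable_up k m m' F : stable_facet k m F -> (m <= m')%N -> stable_facet k m' F.
Proof.
move=> h; elim: m' => [|m' IH]; first by rewrite leqn0 => /eqP <-.
rewrite leq_eqVlt => /orP[/eqP <- //|/IH [w sw [hw ->]]].
exists (None :: w); rewrite /= ?sw //; split=> //.
by rewrite sphw_00 //; apply: sphw_zero_size.
Qed.

Lemma stable_facn k m n F : stable_facet k m F -> (m <= n)%N -> facet k n F.
Proof. by move=> h hm; apply/stable_fac/(stable_up h). Qed.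

Lemma stable_of_fac k n F : (k.*2.+1 < n)%N -> facet k n.+1 F ->
  (forall x, x \in F -> absz x <= n)%N -> stable_facet k n F.
Proof.
move=> hn [[|[e|] w] //= [sw] [hw ->]] h; last by exists w.
by have := h (signed e (size w).+1); rewrite !inE eqxx => /(_ isT); rewrite abs_signed sw ltnn.
Qed.

(** Facets created after stage [j] contain a vertex of absolute value above [j], so [F] was already
    present at stage [j]. *)
Lemma facet_down k j n F : (k.*2.+1 < j)%N -> (j <= n)%N -> facet k n F ->
  (forall x, x \in F -> absz x <= j)%N -> facet k j F.
Proof.
move=> hj; elim: n => [|n IH]; first by rewrite leqn0 => /eqP <-.
rewrite leq_eqVlt => /orP[/eqP -> //|jn] h hF; apply: IH => //.
apply/stable_fac/stable_of_fac => //; first by lia.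
by move=> x /hF; lia.
Qed.

(** The gap at [j + 1] makes the new facet stable. Stability of [F] excludes level 2, and also level
    4, since that ball lies in the antipode of the one at level 2. *)
Lemma stable_far k m j F : stable_facet k m F -> (m < j)%N ->
  stable_facet k.+1 j.+2 (Posz j.+2 |` (Posz j |` F)).
Proof.
case: j => // j h hm; have [w sw [hw ->]] := stable_up h hm.
have sz := sphw_zero_size hw; move: hw; rewrite sphw_zero // => /and3P[h1 h2 h3].
exists [:: Some true, None, Some true & w]; rewrite /= ?sw //; split=> //.
rewrite doubleS sphw_0p0 /=; last by lia.
rewrite sphw_p0p // ?odd_d // h1 h2 /=; apply: contra h3 => h4.
by apply: ballw_wneg_sub; rewrite ?size_wneg ?wnegK // addn2 /= negbK odd_double.
Qed.

Lemma facet_pp k n F : facet k n F -> (k.*2.+2 < n)%N ->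
  facet k.+1 n.+2 (Posz n.+2 |` (Posz n.+1 |` F)).
Proof.
move=> [w sw [hw ->]] hn; exists [:: Some true, Some true & w]; rewrite /= ?sw //; split=> //.
by rewrite doubleS sphw_pp ?odd_d ?sw.
Qed.

Lemma stable_cycle_edge m F : (0 < m)%N -> cycle_edge m.+1 F ->
  (forall x, x \in F -> absz x <= m)%N -> stable_facet 0 m F.
Proof.
move=> m1 h hF; have m2 : (1 < m.+1)%N by [].
have [w sw hw] := wset_of_cycle_edge m2 h.
case: w sw hw => [|a w] //= [sw] hw.
have ha : a = None.
  case: a hw => [e|] // hw; have := hF (signed e (size w).+1).
  by rewrite -hw !inE eqxx => /(_ isT); rewrite abs_signed sw ltnn.
rewrite ha in hw; exists w => //; split=> //.
by apply/(sphw1P m2); rewrite /= ?sw ?hw.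
Qed.

Lemma stable_edge e i m : (0 < i < m)%N -> stable_facet 0 m [fset signed e i; signed e i.+1].
Proof.
move=> hi; apply: stable_cycle_edge; first by lia.
  by left; exists e, i; split=> //; lia.
by move=> x; rewrite !inE => /orP[] /eqP ->; rewrite abs_signed; lia.
Qed.

(** The edge [{-m, 1}] lies in [-B], hence is not stable on [V m], and [stable_far] does not apply.
    But [sphw_p0p] excludes only [B = {m, -1}] here, level 4 being empty in dimension 1. *)
Lemma stable_special m : (1 < m)%N ->
  stable_facet 1 m.+3 (Posz m.+3 |` (Posz m.+1 |` [fset (- Posz m)%R; Posz 1])).
Proof.
move=> m1; have ce : cycle_edge m [fset signed false m; signed true 1] by right; exists false.
have [w sw hw] := wset_of_cycle_edge m1 ce.
exists [:: Some true, None, Some true & w]; rewrite /= ?sw //; split; last by rewrite hw.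
rewrite sphw_0p0 /= ?sw; last by lia.
rewrite (@sphw_p0p 1) ?sw // (@ballw_high 1 4) // andbT; apply/andP; split; first by apply/(sphw1P m1); rewrite ?hw.
rewrite (@ballw1E m.-1) ?hw; try lia.
rewrite prednK; last by lia.
by apply/eqP => /fsetP/(_ (signed true m)); rewrite !inE eqxx /=; lia.
Qed.

(** In [sphw_pn0n] with [d = 0] only level 1 has a word, the vertex [-1], which appears negated. *)
Lemma stable_y1 m : (0 < m)%N ->
  stable_facet 1 m.+4 (Posz m.+4 |` ((- Posz m.+3)%R |` ((- Posz m.+1)%R |` [fset Posz 1]))).
Proof.
move=> m0; have [|w sw hw] := @wset_surj m [fset signed true 1].
  move=> v; rewrite !inE => /eqP ->; rewrite abs_signed; split; first by lia.
  by rewrite signedN; apply/eqP => /=; lia.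
exists [:: Some true, Some false, None, Some false & w]; rewrite /= ?sw //; split; last by rewrite hw.
rewrite (@sphw_0pn0 1) /= ?sw; last by lia.
rewrite (@sphw_pn0n 0) ?sw // !ballw0E /= addbF; apply/point_bP; rewrite size_wneg sw; split=> //.
by rewrite wset_wneg hw; apply/fsetP => v; rewrite mem_neg_set !inE -(inj_eq oppr_inj) opprK.
Qed.

(** The even-dimensional level 1 met in [sphw_pn0n] becomes level 0 after one more vertex, and the
    complementary ball contains every stable facet. *)
Lemma stable_y2 k m F : stable_facet k m F ->
  stable_facet k.+2 m.+4.+1 (Posz m.+4.+1 |` ((- Posz m.+4)%R |` ((- Posz m.+2)%R |`
     ((- Posz m.+1)%R |` neg_set F)))).
Proof.
move=> [w sw [hw ->]]; have sz := sphw_zero_size hw; move: hw; rewrite sphw_zero // => /and3P[h1 h2 h3].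
exists [:: Some true, Some false, None, Some false, Some false & wneg w].
  by rewrite /= size_wneg sw.
rewrite !doubleS; split; last by rewrite /= size_wneg sw wset_wneg.
rewrite sphw_0pn0 /= ?size_wneg; last by lia.
rewrite (@sphw_pn0n k.*2.+2) /= ?size_wneg; last by lia.
rewrite wnegK !ballw_pos ballw_compl h1 h2 /=.
suff -> : ballw k.*2.+1 4 w = false by [].
apply/negbTE; apply: contra h3 => h4.
by apply: ballw_wneg_sub; rewrite ?size_wneg ?wnegK // addn2 /= negbK odd_double.
Qed.

(** The vertices [j+1, j+3, ..., j+4l-1], added in pairs with the gaps that [stable_far]
    requires. *)
Fixpoint far (j l : nat) : {fset int} :=
  if l is l'.+1 then Posz (j + 4 * l').+3 |` (Posz (j + 4 * l').+1 |` far j l') else fset0.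

Lemma far_bound j l x : x \in far j l -> (Posz j <= x < Posz (j + 4 * l))%R.
Proof.
by elim: l => [|l IH]; rewrite !inE // => /or3P[/eqP ->|/eqP ->|/IH]; lia.
Qed.

Lemma stable_extend k l m F j : stable_facet k m F -> (m < j)%N ->
  stable_facet (k + l) (j + 4 * l) (F `|` far j l).
Proof.
move=> h hm; elim: l => [|l hE] /=.
  by rewrite fsetU0 addn0 muln0 addn0; apply: stable_up h (ltnW hm).
have := stable_far hE (ltnSn _); rewrite addnS => /stable_up h1.
have -> : F `|` (Posz (j + 4 * l).+3 |` (Posz (j + 4 * l).+1 |` far j l)) =
  Posz (j + 4 * l).+3 |` (Posz (j + 4 * l).+1 |` (F `|` far j l)).
  by apply/fsetP => x; rewrite !inE; case: (x \in F); rewrite ?orbT.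
by apply: h1; lia.
Qed.

(** Pigeonhole: [P] and [Q] meet at most two of three consecutive windows of length [L]. *)
Lemma pick3 a L P Q : exists m, (a <= m <= a + L + L)%N /\
  ((P < m) || (m + L <= P))%N /\ ((Q < m) || (m + L <= Q))%N.
Proof.
have [h|h] := boolP (((P < a) || (a + L <= P)) && ((Q < a) || (a + L <= Q)))%N.
  by exists a; lia.
have [h'|h'] := boolP (((P < a + L) || (a + L + L <= P)) && ((Q < a + L) || (a + L + L <= Q)))%N.
  by exists (a + L)%N; lia.
by exists (a + L + L)%N; lia.
Qed.

Lemma facet_extend k l n m B j : stable_facet l m B -> (l <= k)%N -> (m < j)%N -> (j + 4 * k <= n)%N ->
  exists F : {fset int}, [/\ facet k n F, B `<=` F &
    forall x, x \in F -> x \in B \/ (Posz j <= x < Posz (j + 4 * k))%R].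
Proof.
move=> h hl hm hn; have hE := @stable_extend l (k - l) m B j h hm.
rewrite subnKC // in hE; exists (B `|` far j (k - l)); split; first by apply: (stable_facn hE); lia.
  exact: fsubsetUl.
by move=> x; rewrite inE => /orP[|/far_bound]; [left|right; lia].
Qed.

Lemma window k i : (0 < i)%N -> exists F : {fset int}, stable_facet k (i + 2 + 4 * k) F /\
  forall x, x \in F -> (Posz i <= x < Posz (i + 2 + 4 * k))%R.
Proof.
move=> i0; have h : stable_facet 0 i.+1 [fset signed true i; signed true i.+1] by apply: stable_edge; lia.
exists ([fset signed true i; signed true i.+1] `|` far (i + 2) k); split=> [|x].
  by apply: (stable_extend _ h); lia.
by rewrite !inE => /orP[/orP[] /eqP ->|/far_bound] /=; lia.
Qed.

Lemma facet_up_pair k n a j : (0 < a)%N -> (a.+1 < j)%N -> (j + 4 * k <= n)%N ->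
  exists F : {fset int}, [/\ facet k n F, Posz a \in F, Posz a.+1 \in F &
    forall x, x \in F -> [\/ x = Posz a, x = Posz a.+1 | (Posz j <= x < Posz (j + 4 * k))%R]].
Proof.
move=> a0 aj hn; have h : stable_facet 0 a.+1 [fset signed true a; signed true a.+1] by apply: stable_edge; lia.
have [//|F [hF /fsubsetP sF bF]] := @facet_extend k 0 n a.+1 _ j h _ aj hn.
exists F; split=> //; [by apply: sF; rewrite !inE eqxx|by apply: sF; rewrite !inE eqxx orbT|].
move=> x /bF[]; last by constructor 3.
by rewrite !inE => /orP[] /eqP ->; [constructor 1|constructor 2].
Qed.

Lemma facet_one_far k n P Q : (16 * k + 60 <= n)%N ->
  exists F : {fset int}, [/\ facet k.+1 n F, Posz 1 \in F &
    forall x, x \in F -> x = Posz 1 \/ [/\ (4 <= absz x)%N, absz x <> P & absz x <> Q]].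
Proof.
(* The length [4 k + 12] has room for the special facet, up to [m + 3], and for the far vertices,
   below [m + 4 k + 8]. *)
move=> hn; have [m [hm [hP hQ]]] := pick3 4 (4 * k + 12) P Q.
have m1 : (1 < m)%N by lia.
have [|||F [hF /fsubsetP sF bF]] := @facet_extend k.+1 1 n _ _ m.+4 (stable_special m1); try lia.
exists F; split=> //; first by apply: sF; rewrite !inE eqxx !orbT.
move=> x /bF[]; last by right; split; lia.
rewrite !inE => /or3P[/eqP ->|/eqP ->|/orP[] /eqP ->]; [right|right|right|by left]; split; lia.
Qed.

(** Serves to exclude [|p| = a+1], [q = a-1]; for [a = 3] it contains [-q] but not [q]. *)
Lemma facet_three k n a : (2 < a)%N -> (a + 4 * k + 10 <= n)%N ->
  exists F : {fset int}, [/\ facet k.+1 n F, Posz a \in F &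
    forall x, x \in F -> [\/ x = (- Posz 1)%R, x = (- Posz 2)%R, x = Posz a | (Posz a.+2 <= x)%R]].
Proof.
move=> a2 hn; have h : stable_facet 0 2 [fset signed false 1; signed false 2] by apply: stable_edge.
have [|||F [hF /fsubsetP sF bF]] := @facet_extend k.+1 1 n _ _ a.+3 (stable_far h a2); try lia.
exists F; split=> //; first by apply: sF; rewrite !inE eqxx !orbT.
move=> x /bF[]; last by constructor 4; lia.
by rewrite !inE => /or3P[/eqP ->|/eqP ->|/orP[] /eqP ->];
  [constructor 4|constructor 3|constructor 1|constructor 2].
Qed.

(** Serves to exclude the opposite assignment [|p| = a-1], [q = a+1]: the facet contains [-(a+1)]
    but not [a+1]. *)
Lemma facet_alt k n a : (1 < a)%N -> (a + 4 * k + 10 <= n)%N ->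
  exists F : {fset int}, [/\ facet k.+1 n F, Posz a \in F &
    forall x, x \in F -> [\/ x = (- Posz 1)%R, x = Posz a, (x <= - Posz a.+1)%R | (Posz a.+4 <= x)%R]].
Proof.
move=> a1 hn.
have [|||F [hF /fsubsetP sF bF]] := @facet_extend k.+1 1 n _ _ a.+4 (stable_neg (stable_special a1)); try lia.
exists F; split=> //; first by apply: sF; rewrite mem_neg_set !inE eqxx !orbT.
move=> x /bF[]; last by constructor 4; lia.
rewrite mem_neg_set !inE => /or3P[/eqP h|/eqP h|/orP[] /eqP h];
  [constructor 3|constructor 3|constructor 2|constructor 1]; lia.
Qed.

Lemma facet_low_pair k n i a : (0 < i)%N -> (i + 4 * k + 4 <= a)%N -> (a.+2 <= n)%N ->
  exists F : {fset int}, [/\ facet k.+1 n F, Posz a \in F, Posz a.+2 \in F &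
    forall x, x \in F -> [\/ x = Posz a, x = Posz a.+2 | (Posz i <= x < Posz (i + 4 * k + 2))%R]].
Proof.
move=> i0 hi hn; have [F [hF bF]] := window k i0.
have hs : stable_facet k.+1 a.+2 (Posz a.+2 |` (Posz a |` F)) by apply: (stable_far hF); lia.
exists (Posz a.+2 |` (Posz a |` F)); split; rewrite ?inE ?eqxx ?orbT //.
  exact: (stable_facn hs).
move=> x; rewrite !inE => /or3P[/eqP ->|/eqP ->|/bF]; [constructor 2|constructor 1|constructor 3]; lia.
Qed.

Lemma facet_top_pair k n i : (0 < i)%N -> (i + 4 * k + 6 <= n)%N ->
  exists F : {fset int}, [/\ facet k.+1 n F, Posz n \in F, Posz n.-1 \in F &
    forall x, x \in F -> [\/ x = Posz n, x = Posz n.-1 | (Posz i <= x < Posz (i + 4 * k + 2))%R]].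
Proof.
move=> i0 hi; have [F [hF bF]] := window k i0; case: n hi => [|[|n]] hi //; try by lia.
have hf : facet k n F by apply: (stable_facn hF); lia.
exists (Posz n.+2 |` (Posz n.+1 |` F)); split; rewrite ?inE ?eqxx ?orbT //.
  by apply: facet_pp => //; lia.
move=> x; rewrite !inE => /or3P[/eqP ->|/eqP ->|/bF]; [constructor 1|constructor 2|constructor 3]; lia.
Qed.

Lemma stable_y k n : (4 * k + 20 <= n)%N ->
  exists F : {fset int}, [/\ stable_facet k.+1 n F, Posz n \in F, (- Posz n.-1)%R \in F &
    forall x, x \in F -> [/\ (absz x <= n)%N, x <> Posz n.-2, x <> (- Posz n.-2)%R & x <> Posz n.-1]].
Proof.
case: k => [|k] hn.
  case: n hn => [|[|[|[|n]]]] // hn; exists (Posz n.+4 |` ((- Posz n.+3)%R |` ((- Posz n.+1)%R |` [fset Posz 1]))).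
  split; rewrite ?inE ?eqxx ?orbT //; first by apply: stable_y1; lia.
  move=> x; rewrite !inE => /or4P[] /eqP ->; split; lia.
have [F [hF bF]] := @window k 1 isT.
have [m en] : exists m, n = m.+4.+1 by exists (n - 5)%N; lia.
rewrite {n}en in hn *; move: m hn => n hn.
have {}hF : stable_facet k n F by apply: (stable_up hF); lia.
exists (Posz n.+4.+1 |` ((- Posz n.+4)%R |` ((- Posz n.+2)%R |` ((- Posz n.+1)%R |` neg_set F)))).
split; rewrite ?inE ?eqxx ?orbT //; first exact: stable_y2.
move=> x; rewrite !inE mem_neg_set => /or4P[/eqP ->|/eqP ->|/eqP ->|/orP[/eqP ->|/bF]]; split; lia.
Qed.

(** The facet is built on [{2, 4, -1, -5}]. For the vertex [2] it excludes [|p| = 3], [q = 1]. *)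
Lemma facet_minus12 k n : (4 * k + 20 <= n)%N ->
  exists F : {fset int}, [/\ facet k.+1 n F, Posz 2 \in F &
    forall x, x \in F -> x <> Posz 1 /\ absz x <> 3].
Proof.
move=> hn; have h := stable_neg (@stable_y1 1 isT).
have [|||F [hF /fsubsetP sF bF]] := @facet_extend k.+1 1 n _ _ 6 h; try lia.
exists F; split=> //; first by apply: sF; rewrite mem_neg_set !inE eqxx !orbT.
move=> x /bF[]; last by lia.
by rewrite mem_neg_set !inE => /or4P[] /eqP; lia.
Qed.

Lemma stable_vertex k m v : (4 * k + 2 <= m)%N -> (0 < absz v <= m)%N ->
  exists2 F, stable_facet k m F & v \in F.
Proof.
have [e ->] := signedP v; rewrite abs_signed; move: (absz v) => {v} t hm ht.
suff [F hF tF] : exists2 F, stable_facet k m F & Posz t \in F.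
  case: e; first by exists F.
  by exists (neg_set F); [apply: stable_neg|rewrite mem_neg_set opprK].
elim: k m t hm ht => [|k IH] m t hm ht.
  case: (ltnP t m) => htm; [have h : (0 < t < m)%N by lia|have h : (0 < t.-1 < m)%N by lia].
    by exists [fset signed true t; signed true t.+1]; [apply: stable_edge|rewrite !inE eqxx].
  exists [fset signed true t.-1; signed true t.-1.+1]; first exact: stable_edge.
  by rewrite !inE prednK ?eqxx ?orbT; lia.
case: (leqP t (m - 3)) => h3.
  have [||F hF tF] := IH (m - 3)%N t; try lia.
  exists (Posz (m - 2).+2 |` (Posz (m - 2) |` F)); last by rewrite !inE tF !orbT.
  by apply: stable_up (stable_far hF _) _; lia.
case: (t =P m.-1) => htm.
  have [||F hF _] := IH (m - 4)%N 1%N; try lia.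
  exists (Posz (m - 3).+2 |` (Posz (m - 3) |` F)); last by rewrite !inE (_ : t = (m - 3).+2) ?eqxx //; lia.
  by apply: stable_up (stable_far hF _) _; lia.
have [||F hF _] := IH (m - 3)%N 1%N; try lia.
exists (Posz (m - 2).+2 |` (Posz (m - 2) |` F)).
  by apply: stable_up (stable_far hF _) _; lia.
rewrite !inE; apply/or3P; case: (t =P m) => htm'; [constructor 1|constructor 2]; lia.
Qed.

Lemma facet_pair_pos k n v b : (12 * k + 60 <= n)%N -> (0 < absz v < b)%N -> (b <= n)%N ->
  exists F, [/\ facet k.+1 n F, v \in F & Posz b \in F].
Proof.
move=> hn hv hb; case: (leqP (b + 4 * k + 20) n) => h1.
  have [m [B [hB vB bB hm]]] : exists m B, [/\ stable_facet 1 m B, v \in B, Posz b \in B & (m <= b + 3)%N].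
    (* Below [2] there are only [1] and [-1], too few for a stable edge on [V (b-1)]. *)
    case: (b =P 2%N) => [b2|b2].
      have [-> | ->] : v = Posz 1 \/ v = (- Posz 1)%R by lia.
        have h : stable_facet 0 2 [fset signed true 1; signed true 2] by apply: stable_edge.
        have := stable_far h (ltnSn _) => h'; exists 5%N; eexists; split; [exact: h'| | |lia];
          by rewrite ?b2 !inE eqxx ?orbT.
      exists 5%N; eexists; split; [exact: (stable_neg (@stable_special 2 isT))| | |lia];
        by rewrite ?b2 mem_neg_set !inE ?opprK eqxx ?orbT.
    have [||F hF tF] := @stable_vertex 0 b.-1 v; try lia.
    exists b.+2; eexists; split; [apply: (@stable_far 0 b.-1 b F hF); lia| | |lia];
      by rewrite !inE ?tF ?eqxx ?orbT.
  have [|||F [hF /fsubsetP sF bF]] := @facet_extend k.+1 1 n m B m.+1 hB; try lia.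
  by exists F; split=> //; apply: sF.
case: (leqP b.+2 n) => h2.
  have [||F hF tF] := @stable_vertex k b.-1 v; try lia.
  exists (Posz b.+2 |` (Posz b |` F)); split; rewrite ?inE ?eqxx ?tF ?orbT //.
  by apply: (@stable_facn _ b.+2); [apply: stable_far hF _; lia|].
case: (leqP (absz v) (n - 2)) => h3.
  have [||F hF tF] := @stable_vertex k (n - 2) v; try lia.
  have := @facet_pp k (n - 2) F (stable_fac hF) _; rewrite -addn2 => h.
  exists (Posz (n - 2).+2 |` (Posz (n - 2).+1 |` F)); split; first 1 last.
  - by rewrite !inE tF !orbT.
  - by rewrite !inE; apply/or3P; case: (b =P n) => hbn; [constructor 1|constructor 2]; lia.
  have e : (n - 2).+2 = n by lia.
  by rewrite -{1}e; apply: facet_pp; [apply: stable_fac|lia].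
have [-> | ->] : v = Posz n.-1 \/ v = (- Posz n.-1)%R by lia.
  have [||F [hF h4 h5 _]] := @facet_top_pair k n 1; try lia.
  by exists F; rewrite (_ : b = n) //; lia.
have [|F [hF h4 h5 _]] := @stable_y k n; first by lia.
by exists F; rewrite (_ : b = n); [split=> //; apply: stable_fac|lia].
Qed.

(** Two-neighborliness: antipodal pairs are the only pairs of distinct vertices that share no
    facet. *)
Lemma facet_pair k n v w : (12 * k + 60 <= n)%N -> (0 < absz v <= n)%N -> (0 < absz w <= n)%N ->
  v <> w -> v <> (- w)%R -> exists F, [/\ facet k.+1 n F, v \in F & w \in F].
Proof.
move=> hn.
have aux x y : (0 < absz x < absz y)%N -> (absz y <= n)%N ->
    exists F, [/\ facet k.+1 n F, x \in F & y \in F].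
  move=> hxy hy; have [[] ey] := signedP y.
    by have [F [h1 h2 h3]] := facet_pair_pos hn hxy hy; exists F; rewrite ey.
  have [|F [h1 h2 h3]] := @facet_pair_pos k n (- x)%R (absz y) hn _ hy; first by rewrite abszN.
  exists (neg_set F); rewrite !mem_neg_set; split=> //; first exact: facet_neg.
  by rewrite ey /= opprK.
move=> hv hw h1 h2; case: (ltngtP (absz v) (absz w)) => h; last by lia.
  by apply: aux; lia.
by have [||F [f1 f2 f3]] := aux w v; [lia|lia|exists F].
Qed.

(** * Forced vertices near the top, and ridges *)

Lemma facet_top k n F : (2 * k + 8 <= n)%N -> facet k.+1 n F -> Posz n \in F ->
  [\/ Posz n.-1 \in F, (- Posz n.-1)%R \in F | Posz n.-2 \in F].
Proof.
move=> hn [w sw [hw ->]] hF; case: w sw hw hF => [|a [|b [|c w]]] sw; try (move: sw => /=; lia).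
rewrite -{}sw in hn * => hw; rewrite -[Posz _]/(signed true (size [:: b, c & w]).+1) wset_top => /eqP ea.
move: hw; rewrite {}ea.
have h e : signed e (size (c :: w)).+1 \in wset [:: Some true, Some e, c & w].
  by rewrite wset_low ?abs_signed // wset_top.
case: b hn => [[]|] hn; [by move=> _; constructor 1; apply: (h true)|by move=> _; constructor 2; apply: (h false)|].
move: hn; rewrite /= => hn; case: c hn h => [[]|] hn h.
- by move=> _; constructor 3; rewrite /= !inE eqxx ?orbT.
- by rewrite doubleS sphw_p0n //; lia.
by rewrite doubleS sphw_p00 //; lia.
Qed.

(** The cancellation behind [facet_top], one letter further down. The sign of [n-3] serves later to
    tell [n-1] from [-(n-1)]. *)
Lemma facet_top_neg k n F : (2 * k + 8 <= n)%N -> facet k.+1 n F ->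
  Posz n \in F -> (- Posz n.-1)%R \in F ->
  [\/ Posz n.-2 \in F, (- Posz n.-2)%R \in F | (- Posz (n - 3))%R \in F].
Proof.
move=> hn [w sw [hw ->]]; case: w sw hw => [|a [|b [|c [|e w]]]] sw; try (move: sw => /=; lia).
rewrite -{}sw in hn * => hw hF.
move=> hF2; have /eqP ea : a == Some true by rewrite -(wset_top [:: b, c, e & w]).
have /eqP eb : b == Some false by rewrite -(wset_top [:: c, e & w]) -(@wset_low _ a) ?abs_signed.
move: hw; rewrite {}ea {}eb {hF hF2} => hw.
have h : forall x, x \in wset [:: c, e & w] -> x \in wset [:: Some true, Some false, c, e & w].
  by move=> x hx; rewrite !inE hx !orbT.
case: c hn hw h => [[]|] hn hw h.
- by constructor 1; apply: h; rewrite !inE eqxx.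
- by constructor 2; apply: h; rewrite !inE eqxx.
constructor 3; apply: h; case: e hn hw => [[]|] hn; rewrite doubleS.
- by rewrite sphw_pn0p //; move: hn => /=; lia.
- by move=> _; rewrite /= !subSS subn0 !inE eqxx.
by rewrite sphw_pn00 //; move: hn => /=; lia.
Qed.

Lemma facet_ridge k n R x y z : facet k n (x |` R) -> facet k n (y |` R) -> facet k n (z |` R) ->
  x \notin R -> y \notin R -> z \notin R -> x <> y -> x <> z -> y = z.
Proof.
move=> fx fy fz hx hy hz xy xz; apply/eqP; rewrite -[_ == _]negbK; apply/negP => /eqP yz.
have [|r sr hr] := @wset_surj n R.
  move=> v hv; have vx : v \in x |` R by rewrite inE hv orbT.
  split; first exact: facet_bound fx vx.
  by have := facet_opp fx vx; apply: contra => h; rewrite inE h orbT.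
have co t : facet k n (t |` R) -> t \notin R ->
    exists w, [/\ w \in cofaces r, sphw k.*2.+1 w & wset w = t |` R].
  move=> [w sw [hw e]] ht; exists w; split=> //.
  by rewrite mem_cofaces sw sr hr -e fsubsetU1 -!card_wset -e hr cardfsU1 ht !eqxx.
have [wx [cx dx ex]] := co x fx hx.
have [wy [cy dy ey]] := co y fy hy.
have [wz [cz dz ez]] := co z fz hz.
have ne s t ws wt : wset ws = s |` R -> wset wt = t |` R -> s \notin R -> s <> t -> ws != wt.
  move=> es et hs st; apply/eqP => e; move: et; rewrite -e es => /fsetP/(_ s).
  by rewrite !inE eqxx (negbTE hs) !orbF; case: eqP.
have u : uniq [:: wx; wy; wz].
  by rewrite /= !inE negb_or (ne x y) // (ne x z) // (ne y z).
have szr : (k.*2.+1 < size r)%N.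
  rewrite ltnNge; apply/negP => sz; have := nz_sphw dx; move/size_cofaces: (cx) => swx.
  by have := count_size isSome wx; rewrite -/(nz wx) swx; lia.
have : (size [:: wx; wy; wz] <= size (filter (sphw k.*2.+1) (cofaces r)))%N.
  apply: uniq_leq_size => // w; rewrite !inE mem_filter => /or3P[] /eqP ->; exact/andP.
by rewrite size_filter; have := count_cofaces_sphw (odd_d k) szr => /=; lia.
Qed.

(** * Stars with a transversal *)

Definition hit (k n : nat) (v p q : int) : Prop := forall F, facet k n F -> v \in F ->
  [\/ p \in F, (- p)%R \in F | q \in F].

Lemma hit_neg k n v p q : hit k n v p q -> hit k n (- v)%R (- p)%R (- q)%R.
Proof.
move=> h F hF hv; have := h _ (facet_neg hF); rewrite !mem_neg_set => /(_ hv).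
by rewrite -[p in X in [\/ _, X | _]]opprK.
Qed.

Lemma hit_refute k n v p q F : hit k n v p q -> facet k n F -> v \in F ->
  (forall x, x \in F -> [/\ x <> p, x <> (- p)%R & x <> q]) -> False.
Proof. by move=> h hF hv hx; case: (h F hF hv) => /hx[]. Qed.

(* Apart from [a+1], resp. [a-1], the facets used have only large vertices,
   chosen out of reach of [p] and [q]. *)
Lemma hit_up k n a p q : (20 * k + 60 + a <= n)%N -> (0 < a)%N -> hit k n (Posz a) p q ->
  (absz p <> a) -> (q <> Posz a) ->
  (absz p = a.+1 \/ q = Posz a.+1) /\ ((1 < a)%N -> absz p = a.-1 \/ q = Posz a.-1).
Proof.
move=> hn a0 h hp hq; have [j [hj [jp jq]]] := pick3 a.+2 (4 * k) (absz p) (absz q).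
split=> [|a1].
  have [||//|F [hF f1 f2 bF]] := @facet_up_pair k n a j; try lia.
  case: (absz p =P a.+1) => [->|np]; first by left.
  case: (q =P Posz a.+1) => [->|nq]; first by right.
  by exfalso; apply: (hit_refute h hF f1) => x /bF[]; split; lia.
have [||//|F [hF f1 f2 bF]] := @facet_up_pair k n a.-1 j; try lia.
rewrite prednK // in f2 bF.
case: (absz p =P a.-1) => [->|np]; first by left.
case: (q =P Posz a.-1) => [->|nq]; first by right.
by exfalso; apply: (hit_refute h hF f2) => x /bF[]; split; lia.
Qed.

(** For large [a] the remaining vertices are taken from a window far below, out of reach of [p] and
    [q]. Each facet has a single vertex near [a], which must then be accounted for by [p] or [q]. *)
Lemma hit_down k n a p q : (16 * k + 40 <= a)%N -> (a <= n)%N -> hit k.+1 n (Posz a) p q ->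
  (absz p <> a) -> (q <> Posz a) ->
  [/\ absz p = a.-2 \/ q = Posz a.-2,
     (a.+2 <= n)%N -> absz p = a.+2 \/ q = Posz a.+2,
     (a = n.-1) -> absz p = n \/ q = Posz n &
     (a = n) -> absz p = a.-1 \/ q = Posz a.-1].
Proof.
move=> ha an h hp hq; have [i [hi [ip iq]]] := pick3 1 (4 * k + 2) (absz p) (absz q).
split=> [|a1|a1|a1].
- have [|||F [hF f1 f2 bF]] := @facet_low_pair k n i a.-2; try lia.
  have e : a.-2.+2 = a by lia.
  rewrite e in f2 bF.
  case: (absz p =P a.-2) => [->|np]; first by left.
  case: (q =P Posz a.-2) => [->|nq]; first by right.
  by exfalso; apply: (hit_refute h hF f2) => x /bF[]; split; lia.
- have [|||F [hF f1 f2 bF]] := @facet_low_pair k n i a; try lia.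
  case: (absz p =P a.+2) => [->|np]; first by left.
  case: (q =P Posz a.+2) => [->|nq]; first by right.
  by exfalso; apply: (hit_refute h hF f1) => x /bF[]; split; lia.
- have [||F [hF f1 f2 bF]] := @facet_top_pair k n i; try lia.
  rewrite -a1 in f2 bF.
  case: (absz p =P n) => [->|np]; first by left.
  case: (q =P Posz n) => [->|nq]; first by right.
  by exfalso; apply: (hit_refute h hF f2) => x /bF[]; split; lia.
have [||F [hF f1 f2 bF]] := @facet_top_pair k n i; try lia.
rewrite -a1 in f1 f2 bF.
case: (absz p =P a.-1) => [->|np]; first by left.
case: (q =P Posz a.-1) => [->|nq]; first by right.
by exfalso; apply: (hit_refute h hF f1) => x /bF[]; split; lia.
Qed.

Lemma hit_pos k n a p q : (80 * k + 400 <= n)%N -> (0 < a <= n)%N -> hit k.+1 n (Posz a) p q ->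
  (absz p <> a) -> (q <> Posz a) -> a = 2 \/ a = n.
Proof.
move=> hn ha h hp hq; case: (a =P 2%N) => [|a2]; first by left.
case: (a =P n) => [|an]; first by right.
exfalso; case: (a =P 1%N) => [a1|a1].
  have [|F [hF f1 bF]] := @facet_one_far k n (absz p) (absz q); first by lia.
  by rewrite a1 in h hp hq; apply: (hit_refute h hF f1) => x /bF[|[]]; split; lia.
(* The two ranges cover everything: if there is no room above [a], then [a] exceeds [16 k + 40]
   because [n >= 80 k + 400]. *)
case: (leqP (20 * k.+1 + 60 + a) n) => h1.
  have [|h2 h3] := @hit_up k.+1 n a p q h1 _ h hp hq; try lia.
  have {}h3 := h3 ltac:(lia).
  have [[p1 q1]|[p1 q1]] : (absz p = a.+1 /\ q = Posz a.-1) \/ (absz p = a.-1 /\ q = Posz a.+1) by lia.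
    have [||F [hF f1 bF]] := @facet_three k n a; try lia.
    by apply: (hit_refute h hF f1) => x /bF[]; split; lia.
  have [||F [hF f1 bF]] := @facet_alt k n a; try lia.
  by apply: (hit_refute h hF f1) => x /bF[]; split; lia.
have [||h2 h3 h4 _] := @hit_down k n a p q _ _ h hp hq; try lia.
(* This facet lies in [V a] and avoids [a-2] and [-(a-2)], whereas [p] and [q] are, up to sign,
   [a-2] and a vertex above [a]: [n] if [a = n-1], and [a+2] otherwise. *)
have [|F [hF f1 f2 bF]] := @stable_y k a; first by lia.
have {}hF := stable_facn hF (ltac:(lia) : (a <= n)%N).
apply: (hit_refute h hF f1) => x /bF[b1 b2 b3 b4].
have hx b : (a < b)%N -> b <> a.-2 -> absz p = b \/ q = Posz b ->
    [/\ x <> p, x <> (- p)%R & x <> q].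
  clear h3 h4 h1 => hb ba hpq.
  have {h2 hpq} [[p1 q1]|[p1 q1]] : (absz p = a.-2 /\ q = Posz b) \/ (absz p = b /\ q = Posz a.-2) by lia.
    by split; lia.
  by split; lia.
case: (a =P n.-1) => an1; first by apply: (hx n); [lia|lia|exact: h4].
by apply: (hx a.+2); [lia|lia|apply: h3; lia].
Qed.

Lemma hit_two k n p q : (80 * k + 400 <= n)%N -> hit k.+1 n (Posz 2) p q ->
  (absz p <> 2) -> (q <> Posz 2) -> absz p = 1 /\ q = Posz 3.
Proof.
move=> hn h hp hq; have [||h2 h3] := @hit_up k.+1 n 2 p q _ _ h hp hq; try lia.
have {}h3 := h3 isT.
have [[p1 q1]|[p1 q1]] : (absz p = 1 /\ q = Posz 3) \/ (absz p = 3 /\ q = Posz 1) by lia.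
  by [].
exfalso; have [|F [hF f1 bF]] := @facet_minus12 k n; first by lia.
by apply: (hit_refute h hF f1) => x /bF[]; split; lia.
Qed.

(** The roles cannot be exchanged: some facet through [n] contains [-(n-1)] but none of [n-1],
    [n-2], [-(n-2)]. *)
Lemma hit_top k n p q : (80 * k + 400 <= n)%N -> hit k.+1 n (Posz n) p q ->
  (absz p <> n) -> (q <> Posz n) -> absz p = n.-1 /\ q = Posz n.-2.
Proof.
move=> hn h hp hq; have [||h2 _ _ h3] := @hit_down k n n p q _ _ h hp hq; try lia.
have {}h3 := h3 erefl.
have [[p1 q1]|[p1 q1]] : (absz p = n.-1 /\ q = Posz n.-2) \/ (absz p = n.-2 /\ q = Posz n.-1) by lia.
  by [].
exfalso; have [|F [hF f1 f2 bF]] := @stable_y k n; first by lia.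
by apply: (hit_refute h (stable_fac hF) f1) => x /bF[]; split; lia.
Qed.

(** * Symmetries *)

Definition vert (n : nat) (v : int) : bool := (0 < absz v <= n)%N.

(* [F'] in the last two fields is the image of [F] under [g], resp. [f]. *)
Record symmetry (k n : nat) (f g : int -> int) : Prop := Symmetry {
  sym_vert : forall v, vert n v -> vert n (f v);
  sym_vertV : forall v, vert n v -> vert n (g v);
  symK : forall v, vert n v -> g (f v) = v;
  symVK : forall v, vert n v -> f (g v) = v;
  sym_pre : forall F, facet k n F ->
    exists2 F', facet k n F' & forall v, vert n v -> (v \in F') = (f v \in F);
  sym_img : forall F, facet k n F ->
    exists2 F', facet k n F' & forall v, vert n v -> (v \in F') = (g v \in F) }.

Lemma symmetry_opp k n f g :
  symmetry k n f g -> symmetry k n (fun v => - f v)%R (fun v => g (- v)%R).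
Proof.
case=> h1 h2 h3 h4 h5 h6.
have vN v : vert n (- v)%R = vert n v by rewrite /vert abszN.
split=> [v hv|v hv|v hv|v hv|F hF|F hF].
- by rewrite vN h1.
- by rewrite h2 // vN.
- by rewrite opprK h3.
- by rewrite h4 ?vN // opprK.
- have [F' hF' eF'] := h5 _ (facet_neg hF); exists F' => // v hv.
  by rewrite eF' // mem_neg_set.
have [F' hF' eF'] := h6 _ hF; exists (neg_set F'); first exact: facet_neg.
by move=> v hv; rewrite mem_neg_set eF' ?vN.
Qed.

Lemma sym_inj k n f g u v : symmetry k n f g -> vert n u -> vert n v -> f u = f v -> u = v.
Proof. by move=> s hu hv e; rewrite -(symK s hu) e (symK s hv). Qed.

(** If [f (-v)] and [-f v] differed, [facet_pair] would give a facet through [f (-v)] and [f v],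
    whose preimage contains both [v] and [-v]. *)
Lemma sym_opp k n f g v : (12 * k + 60 <= n)%N -> symmetry k.+1 n f g ->
  vert n v -> f (- v)%R = (- f v)%R.
Proof.
move=> hn s hv; apply/eqP; rewrite -[_ == _]negbK; apply/negP => /eqP h.
have hv' : vert n (- v)%R by rewrite /vert abszN.
have [|F [hF h1 h2]] := facet_pair hn (sym_vert s hv') (sym_vert s hv) _ h.
  by move=> /(sym_inj s hv' hv); move: hv; rewrite /vert; lia.
have [F' hF' eF'] := sym_pre s hF.
have a1 : v \in F' by rewrite eF'.
by have := facet_opp hF' a1; rewrite eF' // h1.
Qed.

Lemma sym_hit k n f g v p q : (12 * k + 60 <= n)%N -> symmetry k.+1 n f g ->
  vert n v -> vert n p -> vert n q ->
  hit k.+1 n v p q -> hit k.+1 n (f v) (f p) (f q).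
Proof.
move=> hn s hv hp hq h F hF hvF.
have [F' hF' eF'] := sym_pre s hF.
have hp' : vert n (- p)%R by rewrite /vert abszN.
by have := h F' hF'; rewrite !eF' // (sym_opp hn s) //; apply.
Qed.

Lemma hit_n k n : (2 * k + 8 <= n)%N -> hit k.+1 n (Posz n) (Posz n.-1) (Posz n.-2).
Proof. by move=> hn F; apply: facet_top. Qed.

Lemma hit_cases k n v p q : (80 * k + 400 <= n)%N -> vert n v -> hit k.+1 n v p q ->
  (absz p <> absz v) -> (q <> v) -> absz v = 2 \/ absz v = n.
Proof.
move=> hn hv h hp hq; have [[] ev] := signedP v.
  by rewrite ev in h hq; exact: (@hit_pos k n (absz v) p q hn hv h hp hq).
have h' : hit k.+1 n (Posz (absz v)) (- p)%R (- q)%R.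
  by have := hit_neg h; rewrite {1}ev /= opprK.
apply: (@hit_pos k n (absz v) _ _ hn hv h'); first by rewrite abszN.
by move: hq ev => /=; lia.
Qed.

Lemma sym_abs_inj k n f g u v : (12 * k + 60 <= n)%N -> symmetry k.+1 n f g ->
  vert n u -> vert n v -> absz (f u) = absz (f v) -> absz u = absz v.
Proof.
move=> hn s hu hv h; have [e|e] : f u = f v \/ f u = (- f v)%R by lia.
  by rewrite (sym_inj s hu hv e).
have hv' : vert n (- v)%R by rewrite /vert abszN.
by rewrite (sym_inj s hu hv' (etrans e (esym (sym_opp hn s hv)))) abszN.
Qed.

(* If [f n = 2], the facets on [n - 1] correspond to those on [f (n - 1)] in
   [{1, -1}]; the former have a common vertex once [n] and [n - 2] are
   excluded, the latter do not. *)
Lemma sym_n_not_two k n f g : (80 * k + 400 <= n)%N -> symmetry k.+1 n f g ->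
  f (Posz n) = Posz 2 -> False.
Proof.
move=> hn s fn.
have hn' : (12 * k + 60 <= n)%N by lia.
have vn : vert n (Posz n) by rewrite /vert; lia.
have vn1 : vert n (Posz n.-1) by rewrite /vert; lia.
have vn2 : vert n (Posz n.-2) by rewrite /vert; lia.
have vn3 : vert n (Posz (n - 3)) by rewrite /vert; lia.
have ai := fun u v hu hv h => @sym_abs_inj k n f g u v hn' s hu hv h.
have ht : hit k.+1 n (f (Posz n)) (f (Posz n.-1)) (f (Posz n.-2)).
  by apply: (sym_hit hn' s vn vn1 vn2); apply: hit_n; lia.
rewrite fn in ht.
have [||p1 q1] := hit_two hn ht.
- by rewrite -[2%N]/(absz (Posz 2)) -fn => /(ai _ _ vn1 vn); lia.
- by rewrite -fn => /(sym_inj s vn2 vn); lia.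
have [|F [hF f1 bF]] := @facet_one_far k n (absz (f (Posz (n - 3)))) 0; first by lia.
(* Up to sign, [f n = 2], [f (n-2) = 3] and [f (n-3)] are all avoided by [G]. Its preimage [H] is
   then a facet on [V (n-1)] through [n-1] that contradicts [facet_top]. *)
have [G [hG g1 bG]] : exists G, [/\ facet k.+1 n G, f (Posz n.-1) \in G &
    forall x, x \in G -> absz x = 1 \/ (4 <= absz x)%N /\ absz x <> absz (f (Posz (n - 3)))].
  have [e|e] : f (Posz n.-1) = Posz 1 \/ f (Posz n.-1) = (- Posz 1)%R by lia.
    by exists F; rewrite e; split=> // x /bF[->|[]]; [left|right].
  exists (neg_set F); rewrite e mem_neg_set opprK; split=> //; first exact: facet_neg.
  by move=> x; rewrite mem_neg_set => /bF[h|[]]; [left; lia|rewrite abszN; right].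
have [H hH eH] := sym_pre s hG.
have nb x : vert n x -> absz (f x) = 2 \/ absz (f x) = 3 \/ absz (f x) = absz (f (Posz (n - 3))) ->
    absz (f x) <> 1 -> x \notin H.
  move=> hx hc h1; rewrite eH //; apply/negP => /bG[|[]]; lia.
have n1 : absz (f (Posz (n - 3))) <> 1.
  by move=> h; have := ai _ _ vn3 vn1 (etrans h (esym p1)) => /=; lia.
have on x : vert n x = vert n (- x)%R by rewrite /vert abszN.
have hHn1 x : x \in H -> (absz x <= n.-1)%N.
  move=> hx; have := facet_bound hH hx => hb.
  case: (absz x =P n) => [e|]; last by lia.
  have vx : vert n x by [].
  have : x \notin H.
    apply: nb => //; have [->|->] : x = Posz n \/ x = (- Posz n)%R by lia.
    - by rewrite fn; left.
    - by rewrite (sym_opp hn' s) // fn; left.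
    - by rewrite fn.
    by rewrite (sym_opp hn' s) // fn.
  by rewrite hx.
have hF' : facet k.+1 n.-1 H by apply: (@facet_down k.+1 n.-1 n) => //; rewrite ?doubleS; lia.
have : Posz n.-1 \in H by rewrite eH.
have hn8 : (2 * k + 8 <= n.-1)%N by lia.
move/(facet_top hn8 hF') => [].
- by apply/negP/nb; [exact: vn2|rewrite q1; right; left|rewrite q1].
- apply/negP/nb; first by rewrite -on; exact: vn2.
    by rewrite (sym_opp hn' s vn2) q1; right; left.
  by rewrite (sym_opp hn' s vn2) q1.
have e3 : n.-1.-2 = (n - 3)%N by lia.
by rewrite e3; apply/negP/nb => //; right; right.
Qed.

Lemma sym_fix_top k n f g : (80 * k + 400 <= n)%N -> symmetry k.+1 n f g ->
  f (Posz n) = Posz n -> f (Posz n.-1) = Posz n.-1 /\ f (Posz n.-2) = Posz n.-2.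
Proof.
move=> hn s fn.
have hn' : (12 * k + 60 <= n)%N by lia.
have vn : vert n (Posz n) by rewrite /vert; lia.
have vn1 : vert n (Posz n.-1) by rewrite /vert; lia.
have vn2 : vert n (Posz n.-2) by rewrite /vert; lia.
have vn3 : vert n (- Posz (n - 3))%R by rewrite /vert; lia.
have ai := fun u v hu hv h => @sym_abs_inj k n f g u v hn' s hu hv h.
have ht : hit k.+1 n (f (Posz n)) (f (Posz n.-1)) (f (Posz n.-2)).
  by apply: (sym_hit hn' s vn vn1 vn2); apply: hit_n; lia.
rewrite fn in ht.
have [||p1 q1] := hit_top hn ht.
- by move=> h; have := ai _ _ vn1 vn; rewrite fn h => /(_ erefl) /=; lia.
- by move=> h; have := sym_inj s vn2 vn; rewrite fn h => /(_ erefl); lia.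
split=> //; have [//|e] : f (Posz n.-1) = Posz n.-1 \/ f (Posz n.-1) = (- Posz n.-1)%R by lia.
exfalso; have vN x : vert n (- x)%R = vert n x by rewrite /vert abszN.
(* A facet through [n] and [n-1] that avoids [c] has an image through [n] and [-(n-1)] without
   [-(n-3)]; the rest of it is low, so [n-2] and [-(n-2)] are missed as well, against
   [facet_top_neg]. *)
pose c := g (- Posz (n - 3))%R; have vc : vert n c by apply: (sym_vertV s).
have fc : f c = (- Posz (n - 3))%R by apply: (symVK s).
have [i [hi [ic _]]] := pick3 1 (4 * k + 2) (absz c) 0.
have [||F [hF f1 f2 bF]] := @facet_top_pair k n i; try lia.
have [H hH eH] := sym_img s hF.
have gE x y : vert n x -> f x = y -> g y = x by move=> hx <-; rewrite (symK s).
have fN x : vert n x -> f (- x)%R = (- f x)%R by move=> hx; rewrite (sym_opp hn' s hx).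
have hn8 : (2 * k + 8 <= n)%N by lia.
have in1 : Posz n \in H by rewrite eH // (gE (Posz n)).
have in2 : (- Posz n.-1)%R \in H by rewrite eH ?vN // (gE (Posz n.-1)).
have [] := facet_top_neg hn8 hH in1 in2.
- by rewrite eH // (gE (Posz n.-2)) // => /bF[]; lia.
- by rewrite eH ?vN // (gE (- Posz n.-2)%R) ?vN // ?fN ?q1 // => /bF[]; lia.
rewrite eH // -/c => /bF[] h; last by lia.
- by move: fc; rewrite h fn; lia.
by move: fc; rewrite h e; lia.
Qed.

Lemma sym_fix_down k n f g j : (80 * k + 400 <= n)%N -> symmetry k.+1 n f g ->
  f (Posz n) = Posz n -> (16 * k + 40 <= j <= n)%N -> f (Posz j) = Posz j.
Proof.
move=> hn s fn hj; have [fn1 fn2] := sym_fix_top hn s fn.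
have hn' : (12 * k + 60 <= n)%N by lia.
have [m em] : exists m, j = (n - m)%N by exists (n - j)%N; lia.
rewrite {j}em in hj *; elim/ltn_ind: m hj => m IH hj.
case: (leqP m 2) => m2.
  have [->|[->|->]] : (n - m = n \/ n - m = n.-1 \/ n - m = n.-2)%N by lia.
  - by [].
  - by [].
  by [].
have [j ej] : exists j, j = (n - m)%N by exists (n - m)%N.
rewrite -ej in hj *.
have fx i : (j < i <= n)%N -> f (Posz i) = Posz i.
  by move=> hi; rewrite (_ : i = (n - (n - i))%N); [apply: IH; lia|lia].
have vP i : (0 < i <= n)%N -> vert n (Posz i) by [].
have vN x : vert n (- x)%R = vert n x by rewrite /vert abszN.
have fN x : vert n x -> f (- x)%R = (- f x)%R by move=> hx; rewrite (sym_opp hn' s hx).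
have gx i : (j < i <= n)%N -> g (Posz i) = Posz i.
  by move=> hi; rewrite -{1}(fx i hi) (symK s) //; apply: vP; lia.
have gxN i : (j < i <= n)%N -> g (- Posz i)%R = (- Posz i)%R.
  move=> hi; have hv : vert n (Posz i) by apply: vP; lia.
  by rewrite -{1}(fx i hi) -fN // (symK s) // vN.
have vj : vert n (Posz j) by apply: vP; lia.
have vc := sym_vertV s vj.
(* The window misses the preimage of [j]. As the image of [F] must contain [j], that preimage is [j]
   or the fixed vertex [j + 2]. *)
have [i [hi [ic _]]] := pick3 1 (4 * k + 2) (absz (g (Posz j))) 0.
have [|||F [hF f1 f2 bF]] := @facet_low_pair k n i j; try lia.
have [H hH eH] := sym_img s hF.
have hb x : x \in H -> (absz x <= j.+2)%N /\ absz x <> j.+1.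
  move=> hx; have := facet_bound hH hx => hv.
  case: (boolP ((j < absz x)%N && (absz x != j.+2))) => h0; last by lia.
  have hjx : (j < absz x <= n)%N by lia.
  have : g x \in F by rewrite -eH.
  have [[] ex] := signedP x; rewrite ex.
    by rewrite gx // => /bF[] /=; lia.
  by rewrite gxN // => /bF[] /=; lia.
have hH2 : facet k.+1 j.+2 H.
  apply: (@facet_down k.+1 j.+2 n) => //; rewrite ?doubleS; try lia.
  by move=> x /hb[].
have in1 : Posz j.+2 \in H by rewrite eH ?gx // ?vP //; lia.
have hj8 : (2 * k + 8 <= j.+2)%N by lia.
have [h|h|] := facet_top hj8 hH2 in1; [have := (hb _ h).2|have := (hb _ h).2|]; try by move=> /=; lia.
rewrite /= eH // => /bF[h|h|h]; last by lia.
  by rewrite -{1}h (symVK s).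
have := congr1 f h; rewrite (symVK s) // fx; lia.
Qed.

Lemma sym_fix_pos k n f g a : (80 * k + 400 <= n)%N -> symmetry k.+1 n f g ->
  f (Posz n) = Posz n -> (0 < a <= n)%N -> f (Posz a) = Posz a.
Proof.
move=> hn s fn ha.
have [m em] : exists m, a = (n - m)%N by exists (n - a)%N; lia.
rewrite {a}em in ha *; elim/ltn_ind: m ha => m IH ha.
case: (leqP (16 * k + 40) (n - m)) => hm; first by apply: sym_fix_down hn s fn _; lia.
have [a ea] : exists a, a = (n - m)%N by exists (n - m)%N.
rewrite -ea in ha hm *.
have fx i : (a < i <= n)%N -> f (Posz i) = Posz i.
  by move=> hi; rewrite (_ : i = (n - (n - i))%N); [apply: IH; lia|lia].
have vP i : (0 < i <= n)%N -> vert n (Posz i) by [].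
have gx i : (a < i <= n)%N -> g (Posz i) = Posz i.
  by move=> hi; rewrite -{1}(fx i hi) (symK s) //; apply: vP; lia.
have va : vert n (Posz a) by apply: vP; lia.
have hs b : (0 < b)%N -> (b < a.+2)%N ->
    facet k.+1 n ([fset Posz b; Posz b.+1] `|` far a.+3 k.+1).
  move=> b0 b1; have h : stable_facet 0 b.+1 [fset signed true b; signed true b.+1].
    by apply: stable_edge; lia.
  by apply: (stable_facn (@stable_extend 0 k.+1 _ _ a.+3 h _)); lia.
(* All vertices of [R] are already known to be fixed. The far part begins above [a + 3], so that it
   fits both edges [{a, a+1}] and [{a+1, a+2}]. *)
have [R eR] : exists R, R = Posz a.+1 |` far a.+3 k.+1 by eexists.
have bR x : x \in R -> exists2 i, x = Posz i & (a < i <= n)%N /\ i <> a.+2.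
  rewrite eR in_fset1U => /orP[/eqP ->|/far_bound hx]; first by exists a.+1; lia.
  by exists (absz x); lia.
have fa : facet k.+1 n (Posz a |` R).
  by have := hs a; rewrite -fsetUA -eR; apply; lia.
have fb : facet k.+1 n (Posz a.+2 |` R).
  by have := hs a.+1; rewrite [[fset Posz a.+1; _]]fsetUC -fsetUA -eR; apply; lia.
have [H hH eH] := sym_img s fa.
have eHR : H = f (Posz a) |` R.
  apply/fsetP => x; apply/idP/idP => [hx|].
    have vx : vert n x := facet_bound hH hx.
    move: hx; rewrite eH // !in_fset1U => /orP[/eqP e|hR].
      by rewrite -e (symVK s vx) eqxx.
    have [i ei [hi _]] := bR _ hR.
    have ex : f (g x) = g x by rewrite ei fx.
    by rewrite -(symVK s vx) ex hR orbT.
  rewrite in_fset1U => /orP[/eqP ->|hR].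
    by rewrite eH ?(sym_vert s) // (symK s) // fset1U1.
  have [i ei [hi _]] := bR _ hR.
  by rewrite eH ei ?vP ?gx // -?ei ?in_fset1U ?hR ?orbT //; lia.
rewrite eHR in hH.
have naR : Posz a \notin R by apply/negP => /bR[i]; lia.
have nbR : Posz a.+2 \notin R by apply/negP => /bR[i]; lia.
have nfR : f (Posz a) \notin R.
  apply/negP => /bR[i ei [hi _]]; have := congr1 g ei; rewrite (symK s) // gx //; lia.
case: (Posz a =P f (Posz a)) => // h.
have h2 : Posz a <> Posz a.+2 by lia.
have := facet_ridge fa fb hH naR nbR nfR h2 h => /(congr1 g).
by rewrite (symK s) // gx; lia.
Qed.

Lemma symmetry_rigid k n f g : (80 * k + 400 <= n)%N -> symmetry k.+1 n f g ->
  (forall v, vert n v -> f v = v) \/ (forall v, vert n v -> f v = (- v)%R).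
Proof.
move=> hn s0.
have hn' : (12 * k + 60 <= n)%N by lia.
have vn : vert n (Posz n) by rewrite /vert; lia.
have vn1 : vert n (Posz n.-1) by rewrite /vert; lia.
have vn2 : vert n (Posz n.-2) by rewrite /vert; lia.
(* The sign condition selects one of [f] and [-f]; among the candidates of absolute value [2] or [n]
   for the image of [n], it leaves [2] and [n]. *)
have id f1 g1 : symmetry k.+1 n f1 g1 -> (0 <= f1 (Posz n))%R -> forall v, vert n v -> f1 v = v.
  move=> s h v hv.
  have ht : hit k.+1 n (f1 (Posz n)) (f1 (Posz n.-1)) (f1 (Posz n.-2)).
    by apply: (sym_hit hn' s vn vn1 vn2); apply: hit_n; lia.
  have [||f2|fn] := hit_cases hn (sym_vert s vn) ht.
  - by move/(sym_abs_inj hn' s vn1 vn) => /=; lia.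
  - by move/(sym_inj s vn2 vn); lia.
  - by case: (sym_n_not_two hn s); lia.
  have {}fn : f1 (Posz n) = Posz n by lia.
  have fp := sym_fix_pos hn s fn.
  have [[] ev] := signedP v; rewrite ev /=; first exact: fp.
  by rewrite (sym_opp hn' s) ?fp // /vert.
case: (lerP 0 (f (Posz n))) => h; first by left; apply: id s0 h.
right=> v hv; have := id _ _ (symmetry_opp s0) _ v hv; lia.
Qed.

(** * Automorphisms *)

(** By purity, facets are the faces of full size, a description that automorphisms visibly
    preserve. *)
Lemma facetE k n F : (k.*2.+1 < n)%N ->
  facet k n F <-> F \in Delta k.*2.+1 n /\ #|` F| = k.*2.+2.
Proof.
move=> hn; have g := gens_Delta hn; split=> [[w sw [hw ->]]|[/g[w sw [hw hs]] c]].
  by split; [apply/g; exists w|rewrite card_wset (nz_sphw hw)].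
by exists w => //; split=> //; apply/eqP; rewrite eqEfcard hs c card_wset (nz_sphw hw) leqnn.
Qed.

Lemma mem_face_of n (s : {set V n}) (u : V n) : (val u \in face_of s) = (u \in s).
Proof.
apply/imfsetP/idP => [[u' /= hu' /val_inj -> //]|h].
by exists u.
Qed.

Lemma face_of_vert n (s : {set V n}) v : v \in face_of s -> exists2 u : V n, u \in s & v = val u.
Proof. by move=> /imfsetP[u /= hu ->]; exists u. Qed.

Lemma face_ofK n F : (forall v, v \in F -> vert n v) -> face_of [set u : V n | val u \in F] = F.
Proof.
move=> h; apply/fsetP => v; apply/idP/idP => [/face_of_vert[u + ->]|hv].
  by rewrite in_set.
have vV : v \in V n by rewrite mem_V; apply: h.
by rewrite -[v]/(val [` vV]) mem_face_of in_set.
Qed.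

Lemma card_face_of n (s : {set V n}) : #|` face_of s| = #|s|.
Proof.
rewrite /face_of card_imfset; last exact: val_inj.
by rewrite cardE; apply/perm_size/uniq_perm; rewrite ?enum_uniq ?fset_uniq // => u; rewrite mem_enum !inE.
Qed.

(** Extended by the identity outside [V n], so that symmetries are plain functions on integers. *)
Definition act n (phi : {perm V n}) (v : int) : int :=
  if insub v is Some u then val (phi u) else v.

Lemma act_val n (phi : {perm V n}) (u : V n) : act phi (val u) = val (phi u).
Proof. by rewrite /act valK. Qed.

Lemma vertP n v : vert n v -> exists u : V n, v = val u.
Proof. by rewrite /vert -mem_V => h; exists [` h]. Qed.

Lemma vert_val n (u : V n) : vert n (val u).
Proof. by rewrite /vert -mem_V; apply: valP. Qed.

Lemma automorphisms_inv n X (phi : {perm V n}) :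
  phi \in automorphisms n X -> (phi^-1)%g \in automorphisms n X.
Proof.
rewrite !in_set => /forallP h; apply/forallP => s; rewrite eq_sym.
have e : phi @: ((phi^-1)%g @: s) = s.
  by rewrite -imset_comp (eq_imset (g := id)) ?imset_id // => u; rewrite /= permKV.
by have := h ((phi^-1)%g @: s); rewrite e.
Qed.

Lemma automorphisms_pre k n (phi : {perm V n}) F : (k.*2.+1 < n)%N ->
  phi \in automorphisms n (Delta k.*2.+1 n) -> facet k n F ->
  exists2 F', facet k n F' & forall v, vert n v -> (v \in F') = (act phi v \in F).
Proof.
move=> hn; rewrite in_set => /forallP h hF.
have hFv v : v \in F -> vert n v by apply: facet_bound hF.
pose s := [set u : V n | val u \in F].
have es : face_of s = F by apply: face_ofK.
pose t := [set u : V n | val (phi u) \in F].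
have et : phi @: t = s.
  apply/setP => u; apply/imsetP/idP => [[u' + ->]|]; first by rewrite !in_set.
  by rewrite in_set => hu; exists ((phi^-1)%g u); rewrite ?in_set ?permKV.
exists (face_of t); last first.
  by move=> v /vertP[u ->]; rewrite act_val mem_face_of in_set.
have [h1 h2] := (facetE F hn).1 hF.
apply/(facetE _ hn); split; first by rewrite (eqP (h t)) et es.
by rewrite -h2 -es !card_face_of -et card_imset //; apply: perm_inj.
Qed.

Lemma automorphisms_symmetry k n (phi : {perm V n}) : (k.*2.+1 < n)%N ->
  phi \in automorphisms n (Delta k.*2.+1 n) -> symmetry k n (act phi) (act (phi^-1)%g).
Proof.
move=> hn h; split=> [v /vertP[u ->]|v /vertP[u ->]|v /vertP[u ->]|v /vertP[u ->]|F|F].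
- by rewrite act_val vert_val.
- by rewrite act_val vert_val.
- by rewrite !act_val permK.
- by rewrite !act_val permKV.
- exact: automorphisms_pre.
exact/automorphisms_pre/automorphisms_inv.
Qed.

Lemma antipode_automorphism k n : (k.*2.+1 < n)%N ->
  antipode n \in automorphisms n (Delta k.*2.+1 n).
Proof.
move=> hn; rewrite in_set; apply/forallP => s; apply/eqP.
have -> : face_of (antipode n @: s) = neg_set (face_of s).
  apply/fsetP => v; rewrite mem_neg_set; apply/idP/idP.
    move=> /face_of_vert[u /imsetP[u' hu' ->] ->]; rewrite permE opprK.
    by rewrite mem_face_of.
  move=> /face_of_vert[u hu e]; have -> : v = val (antipode n u) by rewrite permE /= -e opprK.
  by rewrite mem_face_of imset_f.
have g := gens_Delta hn.
have sub F : F \in Delta k.*2.+1 n -> neg_set F \in Delta k.*2.+1 n.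
  move=> /g[w sw [hw hs]]; apply/g; exists (wneg w); rewrite ?size_wneg // sphw_wneg; split=> //.
  by rewrite wset_wneg; apply/fsubsetP => v; rewrite !mem_neg_set; apply: (fsubsetP hs).
by apply/idP/idP => /sub //; rewrite neg_setK.
Qed.

Lemma antipode_neq1 n : (0 < n)%N -> (1%g : {perm V n}) != antipode n.
Proof.
move=> n0; have h : vert n 1 by [].
have [u hu] := vertP h; apply/eqP => /permP/(_ u); rewrite !permE => /(congr1 val) /=.
by rewrite -hu.
Qed.

Theorem theorem6p1 (k : nat) (hk : 2 <= k) :
  exists N : nat, forall n : nat, N <= n ->
    automorphisms n (Delta (2 * k - 1) n) = [set 1%g; antipode n] /\
    #|automorphisms n (Delta (2 * k - 1) n)| = 2.
Proof.
(* From here on [k] is the original number minus 2 and the dimension is [2 (k + 1) + 1], which is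
   why the lemmas speak of [facet k.+1]. The bound is generous. *)
case: k hk => [|[|k]] // _; exists (80 * k + 400)%N => n hn.
have -> : (2 * k.+2 - 1 = k.+1.*2.+1)%N by lia.
have dn : (k.+1.*2.+1 < n)%N by lia.
suff -> : automorphisms n (Delta k.+1.*2.+1 n) = [set 1%g; antipode n].
  by split=> //; rewrite cards2 antipode_neq1 //; lia.
apply/setP => phi; rewrite in_set2; apply/idP/idP => [h|/orP[] /eqP ->].
- case: (symmetry_rigid hn (automorphisms_symmetry dn h)) => e; apply/orP; [left|right];
    apply/eqP/permP => u; apply: val_inj; rewrite -act_val e ?vert_val // permE //.
- rewrite in_set; apply/forallP => s; apply/eqP.
  by rewrite (eq_imset (g := id)) ?imset_id // => u; rewrite perm1.
exact: antipode_automorphism.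
Qed.
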